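(* Let $L:(0,\infty)\to(0,\infty)$ be a locally bounded Karamata slowly varying function. Let $f$ be a positive non-decreasing function on $[0,\infty)$ and let $\psi$ be a positive function on $\mathbb{R}$ such that $\psi''\in L^{1}_{loc}(\mathbb{R})$ and $$\int_{-\infty}^{\infty}(\psi(t)+ |\psi'(t)|+|\psi'' (t)|)e^{\beta t+\varepsilon|t|}\, dt <\infty,$$ where $\beta\geq0$ and $\varepsilon>0$. Suppose that the limits $$\lim_{x\to\infty}\frac{e^{2\pi i \xi x}}{e^{\beta x}L(e^{x})} \int _{0}^{\infty} f(t)\psi(t-x)e^{-2\pi i\xi t} \, dt= J(\xi)$$ exist (in $\mathbb{C}$) for every $\xi\in\mathbb{R}$. Then $$\lim_{x\to\infty} \frac{f(x)}{e^{\beta x}L(e^{x})}= \frac{J(0)}{\int_{-\infty}^{\infty}\psi(t)e^{\beta t}\, dt}.$$ Furthermore, if $L$ satisfies $L(xy)\leq A L(x)L(y)$ for all $x,y>0$ and some constant $A$, then the same conclusion holds when the integrability requirement on $\psi$ is relaxed to $$\int_{-\infty}^{\infty}(\psi (t)+|\psi' (t)|+|\psi'' (t)|)L(e^{|t|})e^{\beta t}\, dt<\infty$$ (all other hypotheses being kept).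
   Context: A Karamata slowly varying function is a positive measurable function $L$ with $\lim_{x\to\infty} L(ax)/L(x)=1$ for every $a>0$. Derivatives of $\psi$ are understood in the distributional sense, so that $\psi''\in L^1_{loc}(\mathbb{R})$ means that $\psi$ is (after the usual choice of representative) $C^1$ with locally absolutely continuous derivative $\psi'$. *)

(* Defs.v *)
From mathcomp Require Import all_boot all_order all_algebra.
From mathcomp Require Import all_classical all_reals all_analysis.
From mathcomp Require Import measurable_realfun.
From mathcomp.real_closed Require Import complex.
Import Order.TTheory GRing.Theory Num.Theory.
Import numFieldNormedType.Exports.

Set Implicit Arguments.
Unset Strict Implicit.
Unset Printing Implicit Defensive.

Local Open Scope classical_set_scope.
Local Open Scope ring_scope.
Local Open Scope complex_scope.

(* Measurability in the sense of Lebesgue: the library's [measurable_fun] on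
   [R] is Borel measurability, so the domain is given here the completion of
   the Borel sigma-algebra. *)
Definition lebesgue_measurable_fun (R : realType) (D : set R) (f : R -> R) :=
  @measurable_fun _ _
    (g_sigma_algebraType (completed_algebra_gen (@lebesgue_measure R)))
    (measurableTypeR R) D f.

Definition slowly_varying (R : realType) (L : R -> R) :=
  [/\ forall x, 0 < x -> 0 < L x,
      lebesgue_measurable_fun `]0, +oo[ L &
      forall a, 0 < a -> L (a * x) / L x @[x --> +oo] --> (1 : R)].

Definition test_function (R : realType) (phi : R -> R) :=
  (forall n x, derivable (derive1n n phi) x 1) /\
  compact (closure [set x | phi x != 0]).

(* [dg] is (a representative of) the distributional derivative of [g]. Real
   test functions suffice, by linearity. *)
Definition distributional_derivative (R : realType) (g dg : R -> R) :=
  [/\ locally_integrable [set: R] g, locally_integrable [set: R] dg &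
      forall phi, test_function phi ->
        \int[lebesgue_measure]_x (g x * derive1 phi x) =
        - \int[lebesgue_measure]_x (dg x * phi x)].

Definition expi (R : realType) (theta : R) : R[i] := cos theta +i* sin theta.

Definition cintegrable (R : realType) (D : set R) (g : R -> R[i]) :=
  lebesgue_measure.-integrable D (fun t => (complex.Re (g t))%:E) /\
  lebesgue_measure.-integrable D (fun t => (complex.Im (g t))%:E).

Definition cintegral (R : realType) (D : set R) (g : R -> R[i]) : R[i] :=
  (\int[lebesgue_measure]_(t in D) complex.Re (g t)) +i*
  (\int[lebesgue_measure]_(t in D) complex.Im (g t)).

(* Main.v *)
Require Import Defs.
From mathcomp Require Import all_boot all_order all_algebra.
From mathcomp Require Import all_classical all_reals all_analysis.
From mathcomp Require Import measurable_realfun ring lra.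
From mathcomp.real_closed Require Import complex.
Import Order.TTheory GRing.Theory Num.Theory.
Import numFieldNormedType.Exports.

Set Implicit Arguments.
Unset Strict Implicit.
Unset Printing Implicit Defensive.

Local Open Scope classical_set_scope.
Local Open Scope ring_scope.

(** Extend [f] by 0 to the negative half-line, so that it is nondecreasing on
the whole line, and put [G x = e^(beta x) L(e^x)]; slow variation says that
[G (x + s) / G x] tends to [e^(beta s)].  After the substitution [t = x + u] the
hypothesis reads: the finite measures [f (x + u) psi u du / G x] have Fourier
transforms that converge at every frequency as [x] tends to infinity.  The
value [j = J 0] is the limit of their total masses, so these masses are
bounded.  Write [I x] for the integral of [f (x + u) psi u] over [u]
(later on, [average f psi x]).

Existence of the limit of [f / G] ([ratio_cvg]).  Integrating the transforms
against [T - xi] over [0 <= xi <= T] turns them into integrals of the measures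
against a Fejer kernel placed at any chosen point [a]; these converge too, by
dominated convergence in [xi] ([fejer_average_cvg]).  The kernel is nonnegative,
of size [T^2] within [1/T] of [a], and bounded independently of [T] at distance
[d] from [a].  On the window [|u - a| < d] the monotone function [f (x + u)]
lies between its values at the ends, while the part outside the window counts
at most [O(I x)]; this includes whatever mass escapes to infinity.  If [a] is
a Lebesgue point of [psi], the kernel gives the window a mass of order at least
[T], so for large [T] the outside is negligible ([ratio_upper], [ratio_lower]).
Shrinking [d] pinches [f / G] to a limit [c].

Identification of the limit.  It remains to see [j = c P] where [P] is the
integral of [psi u e^(beta u)], that is, to pass to the limit under the
integral in [I x / G x].  If [j = 0] then [c = 0], because [I] controls [f]
from above ([limit_eq0]).  If [j > 0], then [I] is asymptotic to [j G], it is
nondecreasing like [f], and [f = O(I)].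

With exponential integrability: since [I (x + 1) / I x] tends to [e^beta] and
[I] is monotone, [I y / I x] is at most a constant times
[e^(beta (y - x) + eps |y - x|)] ([exponential_growth_bound]), and this
dominates the integrand.

With [L] submultiplicative: put [lam x = L(e^x)].  The part [u >= -V] is
dominated by means of the supremum over [x] of [I (x + u) / I x], which is
monotone in [u] and at most a constant times [e^(beta u) lam u]
([growth_majorant]).  The bound on [L] gives no such majorant for [u < -V].
Suppose that this part kept a positive mass in the limit, that is, [j - c P = l > 0].
Let [q V] be the integral of [psi u e^(beta u)] over [u < -V].  Comparing [f]
with [e^(beta y)] gives, for large [x],
[lam x <= (2 / l) q(V) sup_(y <= x - V) f y e^(- beta y)].  As [f = O(G)], for
one large [V] this is a maximum principle for [f y e^(- beta y)], which is
therefore bounded; then letting [V] grow makes [lam x] arbitrarily small.  But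
submultiplicativity and slow variation force [lam >= 1 / A], a contradiction
([moment_of_submultiplicative]). *)

(** * Lebesgue integrals on the line *)

Section integration.
Context {R : realType}.
Local Notation mu := (@lebesgue_measure R).
Implicit Types (h f g : R -> R) (D : set R).

Lemma lebesgue_measure_shift (x : R) (A : set R) : measurable A ->
  pushforward mu (+%R x : _ -> measurableTypeR R) A = mu A.
Proof.
move=> mA; apply/esym/lebesgue_measure_unique => //=.
  exact: measurable_funD.
move=> mx _ [[a b]] _ <-.
rewrite /pushforward.
have -> : +%R x @^-1` `]a, b]%classic = `]a - x, b - x]%classic.
  by apply/seteqP; split => u /=; rewrite !in_itv/=; lra.
rewrite !lebesgue_measure_itv/= !lte_fin ltrD2r -!EFinD.
by congr (if _ then _ else _); congr EFin; lra.
Qed.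

(** Integrability of the translate comes with the equality, as both follow from
the invariance of the measure. *)
Lemma Rintegral_shift h x : mu.-integrable setT (EFin \o h) ->
  mu.-integrable setT (EFin \o (fun u => h (x + u))) /\
  \int[mu]_u h (x + u) = \int[mu]_t h t.
Proof.
move=> ih.
pose s (y : R) : measurableTypeR R -> measurableTypeR R := +%R y.
have ms y : measurable_fun setT (s y) by exact: measurable_funD.
have mh : measurable_fun setT (EFin \o h) by case/integrableP: ih.
have mhx : measurable_fun setT (EFin \o (fun u => h (x + u))).
  apply/measurable_EFinP; apply: (@measurableT_comp _ _ _ _ _ _ h) => //.
    exact/measurable_EFinP.
  exact: ms.
have smu y (k : R -> \bar R) : (\int[pushforward mu (s y)]_u k u = \int[mu]_u k u)%E.
  apply: eq_measure_integral => A mA _.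
  exact: lebesgue_measure_shift.
have ihx : mu.-integrable setT (EFin \o (fun u => h (x + u))).
  have := @integrable_pushforward _ _ _ _ _ _ (ms (- x)) mu setT _ mhx.
  rewrite (_ : _ \o s (- x) = EFin \o h).
    by move=> /(_ ih measurableT) /integrableP[_]; rewrite smu => ?; apply/integrableP; split.
  by apply/funext => u; rewrite /s/=; congr (h _)%:E; lra.
split => //.
rewrite /Rintegral; congr fine.
by rewrite -(smu x (EFin \o h)) integral_pushforward.
Qed.

(** The sequential theorem suffices, because convergence at infinity in the reals
is tested on sequences; measurability of the limit is part of what one gets. *)
Lemma dominated_cvg_pinfty D (F : R -> R -> R) f g : measurable D ->
  (\forall x \near +oo, measurable_fun D (F x)) ->
  (forall u, D u -> F x u @[x --> +oo] --> f u) ->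
  mu.-integrable D (EFin \o g) ->
  (\forall x \near +oo, forall u, D u -> `|F x u| <= g u) ->
  mu.-integrable D (EFin \o f) /\
  \int[mu]_(u in D) F x u @[x --> +oo] --> \int[mu]_(u in D) f u.
Proof.
move=> mD mF Ff ig Fg.
have key (v : R^nat) : v n @[n --> \oo] --> +oo ->
    mu.-integrable D (EFin \o f) /\
    \int[mu]_(u in D) F (v n) u @[n --> \oo] --> \int[mu]_(u in D) f u.
  move=> voo.
  have : \forall n \near \oo, measurable_fun D (F (v n)) /\
      forall u, D u -> `|F (v n) u| <= g u.
    by near=> n; split; near: n; [exact: (voo _ mF)|exact: (voo _ Fg)].
  move=> [N _ NF].
  have Ff' u : D u -> (F (v (n + N)%N) u)%:E @[n --> \oo] --> (f u)%:E.
    move=> Du; apply: cvg_EFin; first exact: nearW.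
    rewrite /= (cvg_shiftn N (fun n => F (v n) u)).
    by move/cvg_pinftyP: (Ff u Du); exact.
  have mf : measurable_fun D (EFin \o f).
    apply: (@emeasurable_fun_cvg _ _ _ _ (fun n u => (F (v (n + N)%N) u)%:E)) => //.
    by move=> n; apply/measurable_EFinP; have [] := NF (n + N)%N (leq_addl _ _).
  have [] := @dominated_convergence _ _ _ mu _ mD
    (fun n u => (F (v (n + N)%N) u)%:E) (EFin \o f) (EFin \o g).
  - by move=> n; apply/measurable_EFinP; have [] := NF (n + N)%N (leq_addl _ _).
  - by [].
  - exact/aeW.
  - by [].
  - apply/aeW => u n Du; rewrite /= lee_fin.
    by have [_] := NF (n + N)%N (leq_addl _ _); exact.
  move=> int_f _ H; split => //.
  rewrite -(cvg_shiftn N).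
  apply: fine_cvg; rewrite /= fineK//; exact: integrable_fin_num.
split; last by apply/cvg_pinftyP => v /key[].
by have [] := key (fun n => n%:R) (@cvgr_idn R).
Unshelve. all: by end_near. Qed.
End integration.

Section lower_integral.
Context {R : realType}.
Local Notation mu := (@lebesgue_measure R).

(** The integral of a nonnegative function is defined as a supremum over simple
functions below it, so it is monotone even when neither function is measurable.
It will be applied to [L], which is measurable only for the completed
sigma-algebra. *)
Lemma le_lower_integral (h k : R -> R) : (forall u, 0 <= h u <= k u) ->
  (\int[mu]_u (h u)%:E <= \int[mu]_u (k u)%:E)%E.
Proof.
move=> hk.
rewrite ge0_integralE; last by move=> u _; rewrite lee_fin; have /andP[] := hk u.
rewrite [leRHS]ge0_integralE; last first.
  by move=> u _; rewrite lee_fin; have /andP[h0 /(le_trans h0)] := hk u.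
apply: ge_ereal_sup => /= _ [g /= gf] <-; apply: ereal_sup_ubound.
exists g => // u; apply: le_trans (gf u) _.
by rewrite !patch_setT lee_fin; have /andP[] := hk u.
Qed.

Lemma integrable_le_lower (D : set R) (h k : R -> R) (C : R) :
  measurable (D : set (measurableTypeR R)) -> measurable_fun D h ->
  (forall u, 0 <= k u) -> (forall u, D u -> 0 <= h u <= C * k u) ->
  (\int[mu]_u (k u)%:E < +oo)%E -> mu.-integrable D (EFin \o h).
Proof.
move=> mD mh k0 hk ik.
pose C1 := `|C| + 1.
have C0 : 0 < C1 by rewrite ltr_wpDl.
have i1 : mu.-integrable D (fun u => (C1^-1 * h u)%:E).
  apply/integrableP; split.
    by apply/measurable_EFinP; apply: measurable_funM.
  apply: le_lt_trans ik; rewrite [leLHS]integral_mkcond.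
  have -> : (\int[mu]_u ((fun u => `|(C1^-1 * h u)%:E|%E) \_ D) u =
    \int[mu]_u (((fun u => `|C1^-1 * h u|) \_ D) u)%:E)%E.
    by apply: eq_integral => u _; rewrite !patchE; case: ifPn.
  apply: le_lower_integral => u.
  rewrite patchE; case: ifPn => [|_]; last by rewrite lexx k0.
  rewrite inE normr_ge0 => /hk/andP[h0 hC].
  rewrite ger0_norm ?mulr_ge0 ?invr_ge0 ?(ltW C0)//=.
  rewrite mulrC ler_pdivrMr// mulrC (le_trans hC)// ler_wpM2r//.
  by rewrite /C1 (le_trans (ler_norm C))// lerDl.
apply: eq_integrable (integrableZl mD C1 i1) => // u _ /=.
by rewrite -EFinM mulVKf ?gt_eqF.
Qed.

Lemma measurable_expR_linear (b : R) : measurable_fun setT (fun u : R => expR (b * u)).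
Proof.
apply: continuous_measurable_fun => x.
apply: continuous_comp; last exact: continuous_expR.
by apply: cvgM; [exact: cvg_cst|exact: cvg_id].
Qed.

End lower_integral.

(** * Fubini for bounded kernels *)

Section bounded_fubini.
Context {R : realType}.
Local Notation mu := (@lebesgue_measure R).

Lemma integrableM_bounded (h k : R -> R) (M : R) :
  mu.-integrable setT (EFin \o h) -> measurable_fun setT k ->
  (forall u, `|k u| <= M) -> mu.-integrable setT (fun u => (h u * k u)%:E).
Proof.
move=> ih mk kM.
have mh : measurable_fun setT h by case/integrableP : ih => /measurable_EFinP.
apply: (@le_integrable _ _ _ mu _ measurableT _ (fun u => M%:E * (h u)%:E)%E).
- exact/measurable_EFinP/measurable_funM.
- move=> u _ /=; rewrite lee_fin !normrM mulrC ler_wpM2r//.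
  by rewrite (le_trans (kM u))// ler_norm.
- exact: integrableZl.
Qed.

(** Adding [|w|] makes the integrand nonnegative, so that the measurability half
of Tonelli's theorem applies. *)
Lemma measurable_bounded_transform (w : R -> R) (phi : R -> R -> R) :
  mu.-integrable setT (EFin \o w) ->
  measurable_fun setT (fun z : measurableTypeR R * measurableTypeR R => phi z.1 z.2) ->
  (forall xi u, `|phi xi u| <= 1) ->
  measurable_fun setT (fun u => \int[mu]_xi (w xi * phi xi u)) /\
  forall u, `|\int[mu]_xi (w xi * phi xi u)| <= \int[mu]_xi `|w xi|.
Proof.
move=> iw mphi phi1.
have mw : measurable_fun setT w by case/integrableP : iw => /measurable_EFinP.
have mphi2 u : measurable_fun setT (phi ^~ u).
  exact: (measurableT_comp mphi (pair2_measurable u)).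
have iwphi u := integrableM_bounded iw (mphi2 u) (phi1 ^~ u).
have inw : mu.-integrable setT (fun xi => `|w xi|%:E) by exact: integrable_norm.
split; last first.
  move=> u; apply: (le_trans (le_normr_Rintegral _ (iwphi u))) => //.
  apply: le_Rintegral => //; first exact: (integrable_norm (iwphi u)).
  by move=> xi _ /=; rewrite normrM ler_piMr.
have -> : (fun u => \int[mu]_xi (w xi * phi xi u)) =
    (fun u => \int[mu]_xi (`|w xi| + w xi * phi xi u) - \int[mu]_xi `|w xi|).
  apply/funext => u.
  rewrite (@RintegralD _ _ _ mu setT (fun xi => `|w xi|) (fun xi => w xi * phi xi u)).
  - by rewrite [X in _ = X - _]addrC addrK.
  - exact: measurableT.
  - exact: inw.
  - exact: iwphi.
apply: (@measurable_funB _ _ _ _ _ (cst (\int[mu]_xi `|w xi|))) => //.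
apply: (measurableT_comp (@fine_measurable R setT measurableT)).
pose g (z : measurableTypeR R * measurableTypeR R) : \bar R :=
  (`|w z.1| + w z.1 * phi z.1 z.2)%:E.
apply: (measurable_fun_fubini_tonelli_G g).
  apply/measurable_EFinP.
  have mw1 : measurable_fun setT (fun z : measurableTypeR R * measurableTypeR R => w z.1).
    exact: measurableT_comp.
  by apply: measurable_funD; [exact: measurableT_comp|exact: measurable_funM].
move=> [xi u]; rewrite lee_fin/= -lerBlDl sub0r.
rewrite lerNl (le_trans (ler_norm _))// normrN normrM ler_piMr//.
Qed.

Lemma bounded_fubini (w m : R -> R) (phi : R -> R -> R) :
  mu.-integrable setT (EFin \o w) -> mu.-integrable setT (EFin \o m) ->
  measurable_fun setT (fun z : measurableTypeR R * measurableTypeR R => phi z.1 z.2) ->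
  (forall xi u, `|phi xi u| <= 1) ->
  [/\ mu.-integrable setT (fun xi => (w xi * \int[mu]_u (m u * phi xi u))%:E),
      mu.-integrable setT (fun u => (m u * \int[mu]_xi (w xi * phi xi u))%:E) &
      \int[mu]_u (m u * \int[mu]_xi (w xi * phi xi u)) =
      \int[mu]_xi (w xi * \int[mu]_u (m u * phi xi u))].
Proof.
move=> iw im mphi phi1.
have mw : measurable_fun setT w by case/integrableP : iw => /measurable_EFinP.
have mm : measurable_fun setT m by case/integrableP : im => /measurable_EFinP.
pose f (z : measurableTypeR R * measurableTypeR R) : \bar R := (w z.1 * m z.2 * phi z.1 z.2)%:E.
have mphi1 xi : measurable_fun setT (phi xi).
  exact: (measurableT_comp mphi (pair1_measurable xi)).
have mphi2 u : measurable_fun setT (phi ^~ u).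
  exact: (measurableT_comp mphi (pair2_measurable u)).
have mf : measurable_fun setT f.
  apply/measurable_EFinP; apply: measurable_funM => //.
  apply: measurable_funM.
    by apply: measurableT_comp => //.
  by apply: measurableT_comp => //.
have imphi xi := integrableM_bounded im (mphi1 xi) (phi1 xi).
have iwphi u := integrableM_bounded iw (mphi2 u) (phi1 ^~ u).
have f1 xi : (\int[mu]_u f (xi, u) = (w xi * \int[mu]_u (m u * phi xi u))%:E)%E.
  rewrite /f/=; under eq_integral do rewrite -mulrA EFinM.
  rewrite integralZl// EFinM; congr (_ * _)%E.
  by rewrite /Rintegral fineK//; exact: integrable_fin_num.
have f2 u : (\int[mu]_xi f (xi, u) = (m u * \int[mu]_xi (w xi * phi xi u))%:E)%E.
  rewrite /f/=; under eq_integral do rewrite mulrAC mulrC EFinM.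
  rewrite integralZl// EFinM; congr (_ * _)%E.
  by rewrite /Rintegral fineK//; exact: integrable_fin_num.
have fi : (mu \x mu)%E.-integrable setT f.
  apply/(integrable12ltyP _ _ mf).
  have cm : (\int[mu]_u `|(m u)%:E| < +oo)%E by case/integrableP : im.
  have mf2 : measurable_fun setT (fun xi => \int[mu]_u `|f (xi, u)|)%E.
    apply: (measurable_fun_fubini_tonelli_F (fun z => `|f z|%E)) => //.
    exact: measurableT_comp.
  apply: (@le_lt_trans _ _ (\int[mu]_xi (`|(w xi)%:E| * \int[mu]_u `|(m u)%:E|))%E).
    apply: ge0_le_integral => //.
    - by move=> xi _; exact: integral_ge0.
    - apply: emeasurable_funM => //.
      by apply/measurable_EFinP; exact: measurableT_comp.
    - move=> xi _; rewrite -ge0_integralZl//; last first.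
        by apply: measurableT_comp => //; exact/measurable_EFinP.
      apply: ge0_le_integral => //.
      + apply: measurableT_comp => //.
        exact: (measurableT_comp mf (pair1_measurable xi)).
      + apply: emeasurable_funM => //.
        by apply: measurableT_comp => //; exact/measurable_EFinP.
      + move=> u _; rewrite /f /= -EFinM lee_fin [leLHS]normrM normrM ler_piMr?mulr_ge0//.

  rewrite ge0_integralZr//.
  - by case/integrableP : iw => _ ?; apply: lte_mul_pinfty => //;
       [exact: integral_ge0|rewrite ge0_fin_numE// integral_ge0].
  - by apply: measurableT_comp => //; exact/measurable_EFinP.
  - exact: integral_ge0.
split.
- apply: eq_integrable (integrable_fubini_F fi) => //.
  by move=> xi _; rewrite /fubini_F f1.
- have [mB leB] := measurable_bounded_transform iw mphi phi1.
  exact: integrableM_bounded im mB leB.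
- rewrite /Rintegral; congr fine.
  under eq_integral do rewrite -f2.
  under [RHS]eq_integral do rewrite -f1.
  by rewrite (Fubini fi).
Qed.
End bounded_fubini.

(** * The Fejer kernel *)

Section fejer_kernel.
Context {R : realType}.
Local Notation mu := (@lebesgue_measure R).
Implicit Types (T b xi : R).

Definition tent T : R -> R := (fun xi => T - xi) \_ `[0, T].

(** As a function of [b] this is the Fejer kernel up to normalisation, namely
[(1 - cos (b T)) / b^2]; the integral form covers [b = 0] as well, and is the
one to which Fubini applies. *)
Definition fejer T b := \int[mu]_xi (tent T xi * cos (b * xi)).

Lemma integrable_tent T : mu.-integrable setT (EFin \o tent T).
Proof.
rewrite /tent -restrict_EFin; apply/integrable_restrict => //=.
rewrite setTI; apply: continuous_compact_integrable; first exact: segment_compact.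
apply: continuous_subspaceT => x.
by apply: cvgB; [exact: cvg_cst|exact: cvg_id].
Qed.

Lemma tent_ge0 T xi : 0 <= tent T xi.
Proof.
rewrite /tent patchE; case: ifPn => //; rewrite inE/= in_itv/= subr_ge0.
by case/andP.
Qed.

Lemma fejer_itv T b : fejer T b = \int[mu]_(xi in `[0, T]) ((T - xi) * cos (b * xi)).
Proof.
rewrite /fejer [RHS]Rintegral_mkcond; apply: eq_Rintegral => xi _.
by rewrite /tent !patchE; case: ifPn => //; rewrite mul0r.
Qed.

Let cos_cont b : continuous (fun xi => cos (b * xi)).
Proof.
move=> x; apply: continuous_comp; last exact: continuous_cos.
by apply: cvgM; [exact: cvg_cst|exact: cvg_id].
Qed.

Let fejer_integrable T b :
  mu.-integrable `[0, T] (EFin \o (fun xi => (T - xi) * cos (b * xi))).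
Proof.
apply: continuous_compact_integrable; first exact: segment_compact.
apply: continuous_subspaceT => x; apply: cvgM; last exact: cos_cont.
by apply: cvgB; [exact: cvg_cst|exact: cvg_id].
Qed.

Lemma fejerE T b : 0 < T -> b != 0 -> fejer T b = (1 - cos (b * T)) / b ^+ 2.
Proof.
move=> T0 b0; rewrite fejer_itv /Rintegral.
pose F xi := (T - xi) * sin (b * xi) / b - cos (b * xi) / b ^+ 2.
have dF xi : is_derive xi 1 F ((T - xi) * cos (b * xi)).
  apply: is_derive_eq.
  rewrite !scaler0 !scaler1/= /GRing.scale/=; field.
  exact: b0.
have cF xi : {for xi, continuous F}.
  by apply/differentiable_continuous/derivable1_diffP; have [] := dF xi.
rewrite (@continuous_FTC2 _ _ F) => //.
- rewrite -EFinD/= /F !mulr0 sin0 cos0 subrr.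
  rewrite mul0r mulr0 !mul0r; field.
  exact: b0.
- apply: continuous_subspaceT => x; apply: cvgM; last exact: cos_cont.
  by apply: cvgB; [exact: cvg_cst|exact: cvg_id].
- split.
  + by move=> x _; have [] := dF x.
  + by apply: cvg_at_right_filter; exact: cF.
  + by apply: cvg_at_left_filter; exact: cF.
- by move=> x _; rewrite derive1E; have [_ ->] := dF x.
Qed.

Lemma fejer_ge0 T b : 0 < T -> 0 <= fejer T b.
Proof.
move=> T0; have [->|b0] := eqVneq b 0; last first.
  by rewrite fejerE// divr_ge0 ?sqr_ge0// subr_ge0 cos_le1.
apply: Rintegral_ge0 => xi _.
by rewrite mul0r cos0 mulr1 tent_ge0.
Qed.

Lemma fejer_decay T b : 0 < T -> b ^+ 2 * fejer T b <= 2.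
Proof.
move=> T0; have [->|b0] := eqVneq b 0; first by rewrite expr0n/= mul0r.
rewrite fejerE// mulrC divfK ?expf_neq0//.
by have := cos_geN1 (b * T); lra.
Qed.

(** Below frequency [1 / T] the cosine stays above [cos 1] on the whole support
of the tent, whose area is [T^2 / 2]. *)
Lemma fejer_near0 T b : 0 < T -> `|b| * T <= 1 -> cos 1 * (T ^+ 2 / 2) <= fejer T b.
Proof.
move=> T0 bT.
have -> : T ^+ 2 / 2 = \int[mu]_(xi in `[0, T]) (T - xi).
  pose F xi : R := T * xi - xi ^+ 2 / 2.
  have dF xi : is_derive xi 1 F (T - xi).
    apply: is_derive_eq.
    by rewrite !scaler0 !scaler1/= /GRing.scale/=; field.
  have cF xi : {for xi, continuous F}.
    by apply/differentiable_continuous/derivable1_diffP; have [] := dF xi.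
  rewrite /Rintegral (@continuous_FTC2 _ _ F) => //.
  + by rewrite -EFinD/= /F; field.
  + apply: continuous_subspaceT => x.
    by apply: cvgB; [exact: cvg_cst|exact: cvg_id].
  + split.
    * by move=> x _; have [] := dF x.
    * by apply: cvg_at_right_filter; exact: cF.
    * by apply: cvg_at_left_filter; exact: cF.
  + by move=> x _; rewrite derive1E; have [_ ->] := dF x.
have iT : mu.-integrable `[0, T] (EFin \o (fun xi => T - xi)).
  apply: continuous_compact_integrable; first exact: segment_compact.
  apply: continuous_subspaceT => x.
  by apply: cvgB; [exact: cvg_cst|exact: cvg_id].
rewrite fejer_itv -RintegralZl//.
apply: le_Rintegral => //.
  exact: (integrableZl _ _ iT).
move=> xi /=; rewrite in_itv/= => /andP[xi0 xiT].
rewrite mulrC ler_wpM2l ?subr_ge0//.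
rewrite -[leRHS]cos_norm.
have bxi : `|b * xi| <= 1.
  by rewrite normrM (ger0_norm xi0) (le_trans _ bT)// ler_wpM2l.
have pi1 : 1 <= pi :> R by have := @pi_ge2 R; lra.
have b0pi : `|b * xi| \in `[0, pi] by rewrite in_itv/= normr_ge0 (le_trans bxi).
have i0pi : 1 \in `[0, pi : R] by rewrite in_itv/= ler01.
by rewrite leNgt ltr_cos// -leNgt.
Qed.

End fejer_kernel.

(** * Limits at infinity and Fejer averages *)

Section at_infinity.
Context {R : realType}.
Implicit Types (F : R -> R).

Lemma cvg_shift_pinfty (s : R) : x + s @[x --> +oo] --> +oo.
Proof.
apply/cvgryPge => A; near=> x.
by rewrite -lerBlDr; near: x; apply: nbhs_pinfty_ge; exact: num_real.
Unshelve. all: by end_near. Qed.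

Lemma near_pinfty_shift (P : R -> Prop) s :
  (\forall x \near +oo, P x) -> \forall x \near +oo, P (x + s).
Proof. exact: cvg_shift_pinfty. Qed.

(** The case [e = 1/2] bounds [F] near infinity, hence bounds all the [alpha];
the multiplicative errors then become additive and [F] is Cauchy. *)
Lemma cvg_pinfty_pinched F :
  (\forall x \near +oo, 0 <= F x) ->
  (forall e, 0 < e -> e <= 2^-1 -> exists alpha,
     \forall x \near +oo, (1 - e) * alpha - e <= F x <= (1 + e) * alpha + e) ->
  cvg (F x @[x --> +oo]).
Proof.
move=> F0 Falpha.
have half0 : 0 < 2^-1 :> R by rewrite invr_gt0.
have [a1 Fa1] := Falpha 2^-1 half0 (lexx _).
pose K := (1 + 2^-1) * a1 + 2^-1.
have FK : \forall x \near +oo, 0 <= F x <= K.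
  near=> x; apply/andP; split; first by near: x.
  by have /andP[_] : (1 - 2^-1) * a1 - 2^-1 <= F x <= K by near: x.
apply/cauchy_cvgP/cauchyP => e e0.
have [x0 Fx0] := filter_ex FK.
have K0 : 0 <= K by lra.
(* the oscillation around [al] is at most [d * al + d], where [al <= 2 * K + 1] *)
pose d := Num.min 2^-1 (e / (4 * K + 8)).
have d0 : 0 < d by rewrite lt_min; apply/andP; split; [lra|apply: divr_gt0; lra].
have d2 : d <= 2^-1 by rewrite ge_min lexx.
have dK : d * (4 * K + 8) <= e.
  by rewrite -ler_pdivlMr ?ge_min ?lexx ?orbT//; lra.
have [al Fal] := Falpha d d0 d2.
exists al; suff : \forall x \near +oo, ball al e (F x) by [].
near=> x.
have FxK : 0 <= F x <= K by near: x.
have Fxal : (1 - d) * al - d <= F x <= (1 + d) * al + d by near: x.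
rewrite /ball/= ltr_norml.
nra.
Unshelve. all: by end_near. Qed.

End at_infinity.

Section fejer_average.
Context {R : realType}.
Local Notation mu := (@lebesgue_measure R).

(** Convergence of the transforms at each frequency is integrated over the
compact frequency range of the tent, the total masses giving the majorant. *)
Lemma fejer_average_cvg (m : R -> R -> R) (G : R -> R) (a B T : R) (j : R -> R) :
  (forall x, 0 < G x) ->
  (\forall x \near +oo, mu.-integrable setT (EFin \o m x)) ->
  (\forall x \near +oo, (\int[mu]_u `|m x u|) / G x <= B) ->
  (forall xi, (\int[mu]_u (m x u * cos (2 * pi * (u - a) * xi))) / G x
     @[x --> +oo] --> j xi) ->
  (\int[mu]_u (m x u * fejer T (2 * pi * (u - a)))) / G x @[x --> +oo] -->
     \int[mu]_xi (tent T xi * j xi).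
Proof.
move=> G0 im mB mj.
pose phi (xi u : R) := cos (2 * pi * (u - a) * xi).
have mphi : measurable_fun setT
    (fun z : measurableTypeR R * measurableTypeR R => phi z.1 z.2).
  apply: (measurableT_comp (f := @cos R)).
    by apply: continuous_measurable_fun; exact: continuous_cos.
  apply: measurable_funM; last exact: measurable_fst.
  apply: measurable_funM => //.
  by apply: measurable_funB => //; exact: measurable_snd.
have phi1 xi u : `|phi xi u| <= 1.
  by rewrite ler_norml cos_geN1 cos_le1.
pose A x xi := \int[mu]_u (m x u * phi xi u).
have [_] : mu.-integrable setT (EFin \o (fun xi => tent T xi * j xi)) /\
  \int[mu]_xi (tent T xi * (A x xi / G x)) @[x --> +oo] -->
     \int[mu]_xi (tent T xi * j xi).
  apply: (@dominated_cvg_pinfty _ _ _ _ (fun xi => B * tent T xi)) => //.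
  - near=> x.
    have imx : mu.-integrable setT (EFin \o m x) by near: x.
    have [/integrableP[/measurable_EFinP mtA _] _ _] :=
      bounded_fubini (integrable_tent T) imx mphi phi1.
    under eq_fun do rewrite mulrA.
    exact: measurable_funM.
  - move=> xi _; apply: cvgM; first exact: cvg_cst.
    exact: mj.
  - exact: (integrableZl _ _ (integrable_tent T)).
  - near=> x => xi _.
    rewrite normrM (ger0_norm (tent_ge0 _ _)) mulrC ler_wpM2r ?tent_ge0//.
    have imx : mu.-integrable setT (EFin \o m x) by near: x.
    have mphi2 : measurable_fun setT (phi xi).
      exact: (measurableT_comp mphi (pair1_measurable xi)).
    have imphi := integrableM_bounded imx mphi2 (phi1 xi).
    have mBx : (\int[mu]_u `|m x u|) / G x <= B by near: x.
    apply: le_trans mBx.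
    rewrite normrM normfV (gtr0_norm (G0 x)) ler_wpM2r ?invr_ge0 ?(ltW (G0 x))//.
    apply: (le_trans (le_normr_Rintegral _ imphi)) => //.
    apply: le_Rintegral => //; [exact: (integrable_norm imphi)|exact: integrable_norm|].
    by move=> u _; rewrite normrM ler_piMr.
apply: cvg_trans; apply: near_eq_cvg; near=> x.
have imx : mu.-integrable setT (EFin \o m x) by near: x.
have [iwA _ fub] := bounded_fubini (integrable_tent T) imx mphi phi1.
under eq_Rintegral do rewrite mulrA.
rewrite (@RintegralZr _ _ _ mu setT (fun xi => tent T xi * A x xi) (G x)^-1 measurableT iwA).
apply: (congr1 (fun z => z / G x)); rewrite -fub.
apply: eq_Rintegral => u _; congr (_ * _).
Unshelve. all: by end_near. Qed.

End fejer_average.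

(** * Points of positive density *)

Section density_point.
Context {R : realType}.
Local Notation mu := (@lebesgue_measure R).

Lemma locally_integrable_ball (psi : R -> R) a r :
  locally_integrable setT psi -> mu.-integrable (ball a r) (EFin \o psi).
Proof.
case=> mpsi _ ipsi.
have ii : mu.-integrable `[a - r, a + r] (EFin \o psi).
  apply/integrableP; split; first exact/measurable_EFinP/measurable_funTS.
  by apply: ipsi => //; exact: segment_compact.
apply: integrableS ii => //; first exact: measurable_ball.
by rewrite ball_itv; exact: subset_itv_oo_cc.
Qed.

(** At a Lebesgue point the averages of [psi] over small balls come close to its
positive value there; a ball of radius [r] has length [2 r], and half of the
value at the point is given up. *)
Lemma positive_mass_near_point (psi : R -> R) :
  locally_integrable setT psi -> (forall t, 0 < psi t) ->
  exists a c r0, [/\ 0 < c, 0 < r0 &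
    forall r, 0 < r -> r < r0 -> c * r <= \int[mu]_(u in ball a r) psi u].
Proof.
move=> lpsi psi0.
have [a apt] : exists a, lebesgue_pt psi a.
  apply: contrapT => /forallNP nopt.
  have [N [mN N0 subN]] := lebesgue_differentiation lpsi.
  have : (mu [set: R] <= mu N)%E by apply: le_measure; rewrite ?inE// => x _; exact/subN/nopt.
  by rewrite N0 -set_itvNyy lebesgue_measure_itv/= => /(lt_le_trans (ltry 0)); rewrite ltxx.
have : \forall r \near 0^'+, (davg psi a r < (psi a / 2)%:E)%E.
  have /fine_cvgP[fin /cvgr_lt lt] := apt.
  have /lt {}lt : 0 < psi a / 2 by rewrite divr_gt0.
  near=> r; have fr : davg psi a r \is a fin_num by near: r.
  by rewrite -(fineK fr) lte_fin; near: r.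
move=> /nbhs_right0P /= [r0 r00 Hr].
exists a, (psi a), r0; split => // r r0' rr0.
have := Hr r; rewrite /= sub0r normrN (gtr0_norm r0') => /(_ rr0 r0').
rewrite add0r.
have ib := locally_integrable_ball a r lpsi.
have mb : measurable (ball a r : set (measurableTypeR R)) by exact: measurable_ball.
have ic : mu.-integrable (ball a r) (EFin \o cst (psi a)).
  apply: measurable_bounded_integrable => //.
    by rewrite [ltLHS](lebesgue_measure_ball a (ltW r0')) ltry.
  by exists `|psi a|; split; [exact: num_real|move=> M /ltW PM u _].
have id : mu.-integrable (ball a r) (EFin \o (fun y => psi y - psi a)).
  by apply: eq_integrable (integrableB mb ib ic) => // y _; rewrite /= EFinB.
have ind : mu.-integrable (ball a r) (EFin \o (fun y => `|psi y - psi a|)).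
  exact: (integrable_norm id).
rewrite /davg /iavg lebesgue_measure_ball ?(ltW r0')//.
rewrite (_ : (\int[mu]_(y in _) _)%E = (\int[mu]_(y in ball a r) `|psi y - psi a|)%:E); last first.
  by rewrite /Rintegral fineK//; exact: integrable_fin_num.
rewrite inver mulrn_eq0/= gt_eqF// -EFinM lte_fin ltr_pdivrMl ?mulrn_wgt0// => Hd.
have : \int[mu]_(u in ball a r) (psi a - `|psi u - psi a|) <= \int[mu]_(u in ball a r) psi u.
  apply: le_Rintegral => //; first 
    by apply: eq_integrable (integrableB mb ic ind) => // y _; rewrite /= EFinB.
  move=> u _; have := ler_norm (psi a - psi u); rewrite distrC; lra.
have mub : fine (mu (ball a r)) = r *+ 2 by rewrite lebesgue_measure_ball ?(ltW r0').
rewrite (RintegralB mb ic ind) Rintegral_cst// [fine _]mub => H.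
apply: le_trans H; move: Hd; rewrite -mulr_natl; lra.
Unshelve. all: by end_near. Qed.
End density_point.

(** * Squeezing a monotone function in a window *)

Section fejer_window.
Context {R : realType}.
Local Notation mu := (@lebesgue_measure R).
Variables (f psi : R -> R).
Hypothesis f_nd : {homo f : x y / x <= y}.
Hypothesis f_ge0 : forall x, 0 <= f x.
Hypothesis psi_gt0 : forall u, 0 < psi u.
Hypothesis psi_loc : locally_integrable setT psi.
Variables (a d T : R).
Hypotheses (d0 : 0 < d) (T0 : 0 < T).

Definition fejer_at u := fejer T (2 * pi * (u - a)).

Definition window_mass := \int[mu]_(u in ball a d) (psi u * fejer_at u).

Lemma fejer_at_ge0 u : 0 <= fejer_at u. Proof. exact: fejer_ge0. Qed.

Lemma fejer_at_measurable_bounded : measurable_fun setT fejer_at /\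
  exists M, forall u, `|fejer_at u| <= M.
Proof.
have [] := @measurable_bounded_transform R (tent T)
  (fun xi u => cos (2 * pi * (u - a) * xi)) (integrable_tent T) _ _.
- apply: (measurableT_comp (f := @cos R)).
    by apply: continuous_measurable_fun; exact: continuous_cos.
  apply: measurable_funM; last exact: measurable_fst.
  apply: measurable_funM => //.
  by apply: measurable_funB => //; exact: measurable_snd.
- by move=> xi u; rewrite ler_norml cos_geN1 cos_le1.
by move=> mk kM; split => //; eexists; exact: kM.
Qed.

Lemma fejer_at_far u : ~ ball a d u -> fejer_at u <= 2 / (2 * pi * d) ^+ 2.
Proof.
rewrite /ball/= => /negP; rewrite -leNgt => du.
have pid : 0 < 2 * pi * d by rewrite !mulr_gt0// pi_gt0.
rewrite ler_pdivlMr ?exprn_gt0// mulrC.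
apply: le_trans (fejer_decay (2 * pi * (u - a)) T0).
apply: ler_wpM2r; first exact: fejer_at_ge0.
rewrite -(real_normK (num_real (2 * pi * (u - a)))) ler_sqr ?nnegrE ?(ltW pid)//.
by rewrite normrM distrC ger0_norm ?ler_pM2l// ?mulr_gt0 ?mulr_ge0 ?pi_gt0 ?pi_ge0.
Qed.

Lemma integrable_window :
  mu.-integrable (ball a d) (EFin \o (fun u => psi u * fejer_at u)).
Proof.
have [mk [M kM]] := fejer_at_measurable_bounded.
have mb : measurable (ball a d : set (measurableTypeR R)) by exact: measurable_ball.
have mpsi : measurable_fun setT psi by case: psi_loc.
apply: (@le_integrable _ _ _ mu _ mb _ (fun u => M%:E * (psi u)%:E)%E).
- by apply/measurable_EFinP/measurable_funTS; exact: measurable_funM.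
- move=> u _ /=; rewrite lee_fin !normrM mulrC ler_wpM2r//.
  by rewrite (le_trans (kM u))// ler_norm.
- by apply: integrableZl => //; exact: locally_integrable_ball.
Qed.

Let integrable_patch_window :
  mu.-integrable setT (EFin \o ((fun u => psi u * fejer_at u) \_ (ball a d))).
Proof.
rewrite -restrict_EFin.
have mb : measurable (ball a d : set (measurableTypeR R)) by exact: measurable_ball.
by apply/integrable_restrict => //; rewrite setTI; exact: integrable_window.
Qed.

Let integrable_indicator_window (y : R) :
  mu.-integrable setT (fun u => (y * ((fun u => psi u * fejer_at u) \_ (ball a d)) u)%:E).
Proof. exact: (integrableZl measurableT y integrable_patch_window). Qed.

Let window_massE (y : R) : y * window_mass =
  \int[mu]_u (y * ((fun u => psi u * fejer_at u) \_ (ball a d)) u).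
Proof.
by rewrite (RintegralZl _ measurableT integrable_patch_window) /window_mass Rintegral_mkcond.
Qed.

(** The left end of the window bounds [f] from below on all of it. *)
Lemma window_lower y :
  mu.-integrable setT (fun u => (f (y + u) * psi u)%:E) ->
  f (y + a - d) * window_mass <= \int[mu]_u (f (y + u) * psi u * fejer_at u).
Proof.
move=> im; have [mk [M kM]] := fejer_at_measurable_bounded.
rewrite window_massE; apply: le_Rintegral => //.
- exact: integrable_indicator_window.
- exact: (integrableM_bounded im mk kM).
move=> u _; rewrite patchE; case: ifPn => [|_]; last first.
  by rewrite mulr0 !mulr_ge0 ?fejer_at_ge0// ltW.
rewrite inE /ball/= ltr_norml => /andP[u1 u2].
rewrite mulrA ler_wpM2r ?fejer_at_ge0// ler_wpM2r ?(ltW (psi_gt0 _))//.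
apply: f_nd; lra.
Qed.

(** The right end of the window bounds [f] from above on it, and outside of it
the kernel is bounded independently of [T]. *)
Lemma window_upper y :
  mu.-integrable setT (fun u => (f (y + u) * psi u)%:E) ->
  \int[mu]_u (f (y + u) * psi u * fejer_at u) <= f (y + a + d) * window_mass +
    2 / (2 * pi * d) ^+ 2 * \int[mu]_u (f (y + u) * psi u).
Proof.
move=> im; have [mk [M kM]] := fejer_at_measurable_bounded.
set s := 2 / _.
have s0 : 0 <= s by rewrite divr_ge0// sqr_ge0.
have ism : mu.-integrable setT (fun u => (s * (f (y + u) * psi u))%:E).
  exact: (integrableZl measurableT s im).
rewrite window_massE -(RintegralZl s measurableT im).
rewrite -(RintegralD measurableT (integrable_indicator_window _) ism).
apply: le_Rintegral => //.
- exact: (integrableM_bounded im mk kM).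
- exact: (integrableD measurableT (integrable_indicator_window _) ism).
move=> u _; have m0 : 0 <= f (y + u) * psi u by rewrite mulr_ge0// ltW.
rewrite patchE; case: ifPn => [|/negP].
  rewrite inE => ub; rewrite -[leLHS]addr0; apply: (lerD _ (mulr_ge0 s0 m0)).
  move: ub; rewrite /ball/= ltr_norml => /andP[u1 u2].
  rewrite mulrA ler_wpM2r ?fejer_at_ge0// ler_wpM2r ?(ltW (psi_gt0 _))//.
  apply: f_nd; lra.
move=> nub; have /fejer_at_far us : ~ ball a d u.
  by move=> ub; apply: nub; rewrite inE.
by rewrite mulr0 add0r mulrC ler_wpM2r.
Qed.

End fejer_window.

Section ratio.
Context {R : realType}.
Local Notation mu := (@lebesgue_measure R).
Variables (f psi G : R -> R) (beta : R).
Hypothesis f_nd : {homo f : x y / x <= y}.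
Hypothesis f_ge0 : forall x, 0 <= f x.
Hypothesis psi_gt0 : forall u, 0 < psi u.
Hypothesis psi_loc : locally_integrable setT psi.
Hypothesis G_gt0 : forall x, 0 < G x.
Hypothesis G_shift : forall s, G (x + s) / G x @[x --> +oo] --> expR (beta * s).
Hypothesis f_int : \forall x \near +oo,
  mu.-integrable setT (fun u => (f (x + u) * psi u)%:E).
Variable j0 : R.
Hypothesis average_cvg :
  (\int[mu]_u (f (x + u) * psi u)) / G x @[x --> +oo] --> j0.

(** The window is placed with its left end at [x], which costs a translation
of [G] by [d - a]. *)
Lemma ratio_upper a d T : 0 < d -> 0 < T -> 0 < window_mass psi a d T -> forall Lam e,
  (\int[mu]_u (f (x + u) * psi u * fejer_at a T u)) / G x @[x --> +oo] --> Lam ->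
  0 < e ->
  \forall x \near +oo,
    f x / G x <= expR (beta * d) * (expR (- (beta * a)) * Lam / window_mass psi a d T) + e.
Proof.
move=> d0 T0 P0 Lam e MG e0.
set P := window_mass _ _ _ _ in P0 *.
pose U y := (\int[mu]_u (f (y + u) * psi u * fejer_at a T u)) / G y.
have UL : U (x + (d - a)) * (G (x + (d - a)) / G x) / P @[x --> +oo] -->
    Lam * expR (beta * (d - a)) / P.
  apply: cvgMl; apply: cvgM; last exact: G_shift.
  exact: (cvg_comp _ _ (cvg_shift_pinfty (d - a)) MG).
have e1 : expR (beta * d) * (expR (- (beta * a)) * Lam / P) = Lam * expR (beta * (d - a)) / P.
  have -> : beta * (d - a) = beta * d + - (beta * a) by ring.
  by rewrite expRD; ring.
rewrite e1; near=> x.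
apply: (@le_trans _ _ (U (x + (d - a)) * (G (x + (d - a)) / G x) / P)); last first.
  near: x; apply: (cvgr_le _ UL); by rewrite ltrDl.
rewrite ler_pdivlMr// mulrA /U divfK ?gt_eqF// mulrAC ler_pM2r ?invr_gt0//.
have -> : f x = f (x + (d - a) + a - d) by congr f; ring.
apply: window_lower => //.
by near: x; exact: near_pinfty_shift f_int.
Unshelve. all: by end_near. Qed.

(** The window is placed with its right end at [x], which costs a translation
of [G] by [- a - d]. *)
Lemma ratio_lower a d T : 0 < d -> 0 < T -> 0 < window_mass psi a d T -> forall Lam e,
  (\int[mu]_u (f (x + u) * psi u * fejer_at a T u)) / G x @[x --> +oo] --> Lam ->
  0 < e ->
  \forall x \near +oo,
    expR (- (beta * d)) * (expR (- (beta * a)) *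
      (Lam - 2 / (2 * pi * d) ^+ 2 * j0) / window_mass psi a d T) - e <= f x / G x.
Proof.
move=> d0 T0 P0 Lam e MG e0.
set P := window_mass _ _ _ _ in P0 *.
set s := 2 / _.
pose U y := (\int[mu]_u (f (y + u) * psi u * fejer_at a T u)) / G y.
pose V y := (\int[mu]_u (f (y + u) * psi u)) / G y.
have UL : (U (x + (- a - d)) - s * V (x + (- a - d))) * (G (x + (- a - d)) / G x) / P
    @[x --> +oo] --> (Lam - s * j0) * expR (beta * (- a - d)) / P.
  apply: cvgMl; apply: cvgM; last exact: G_shift.
  apply: cvgB; first exact: (cvg_comp _ _ (cvg_shift_pinfty (- a - d)) MG).
  apply: cvgMr.
  exact: (cvg_comp _ _ (cvg_shift_pinfty (- a - d)) average_cvg).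
have e1 : expR (- (beta * d)) * (expR (- (beta * a)) * (Lam - s * j0) / P) =
   (Lam - s * j0) * expR (beta * (- a - d)) / P.
  have -> : beta * (- a - d) = - (beta * a) + - (beta * d) by ring.
  by rewrite expRD; ring.
rewrite e1; near=> x.
apply: (@le_trans _ _ ((U (x + (- a - d)) - s * V (x + (- a - d))) *
    (G (x + (- a - d)) / G x) / P)).
  near: x; apply: (cvgr_ge _ UL); by rewrite ltrBlDr ltrDl.
rewrite /U /V; set y := x + (- a - d); set MU := \int[mu]_u _; set MV := \int[mu]_u _.
have -> : (MU / G y - s * (MV / G y)) * (G y / G x) / P = (MU - s * MV) / P / G x.
  by field; rewrite !gt_eqF.
rewrite ler_pM2r ?invr_gt0// ler_pdivrMr// lerBlDr /MU /MV /y.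
have -> : f x = f (x + (- a - d) + a + d) by congr f; ring.
apply: window_upper => //.
by near: x; exact: near_pinfty_shift f_int.
Unshelve. all: by end_near. Qed.

(** Both one-sided bounds involve the same number [al]: they differ by the factors
[e^(beta d)] and [e^(- beta d)], removed by shrinking [d], and by the contribution
of the kernel outside the window, which is divided by a window mass of order [T]. *)
Lemma ratio_cvg :
  (forall a xi, cvg ((\int[mu]_u (f (x + u) * psi u * cos (2 * pi * (u - a) * xi))) / G x
     @[x --> +oo])) ->
  cvg (f x / G x @[x --> +oo]).
Proof.
move=> fourier.
have [a [c [r0 [c0 r00 massa]]]] := positive_mass_near_point psi_loc psi_gt0.
have G_ge0 x : 0 <= G x by exact: ltW.
have m_ge0 x u : 0 <= f (x + u) * psi u by rewrite mulr_ge0// ltW.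
have j0_ge0 : 0 <= j0.
  rewrite -(cvg_lim (@Rhausdorff R) average_cvg); apply: limr_ge.
    by apply/cvg_ex; exists j0.
  by apply: nearW => x; rewrite divr_ge0// Rintegral_ge0.
apply: cvg_pinfty_pinched.
  by apply: nearW => x; rewrite divr_ge0.
move=> e e0 e2.
(* from [1 + y <= expR y] and [|beta * d| <= e / 2] *)
have [d [d0 dup dlo]] : exists d, [/\ 0 < d, expR (beta * d) <= 1 + e &
    1 - e <= expR (- (beta * d))].
  have nb0 : 0 <= `|beta| := normr_ge0 _.
  exists (e / 2 / (`|beta| + 1)); set d := e / 2 / _.
  have bd : `|beta * d| <= e / 2.
    rewrite normrM (ger0_norm (_ : 0 <= d)); last by rewrite !divr_ge0 ?(ltW e0)//; lra.
    by rewrite /d mulrA ler_pdivrMr; nra.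
  move: bd; rewrite ler_norml => /andP[bd1 bd2].
  have ge1 := expR_ge1Dx (- (beta * d)).
  have eN : expR (beta * d) * expR (- (beta * d)) = 1 by rewrite -expRD subrr expR0.
  have ep := expR_gt0 (beta * d).
  split; [rewrite /d !divr_gt0//; lra|nra|lra].
pose b := expR (- (beta * a)) * expR (- (beta * d)).
have b0 : 0 < b by rewrite mulr_gt0 ?expR_gt0.
pose s := 2 / (2 * pi * d) ^+ 2.
have s0 : 0 < s by rewrite divr_gt0// exprn_gt0// !mulr_gt0// pi_gt0.
(* the right-hand side of the last bound is linear in [T] *)
have [T [T0 Tr0 TP]] : exists T, [/\ 0 < T, (2 * pi * T)^-1 < Num.min d r0 &
    b * (s * j0) <= e / 2 * (cos 1 * (T ^+ 2 / 2) * (c * (2 * pi * T)^-1))].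
  have pi0 := @pi_gt0 R; have cos0 := @cos1_gt0 R.
  have dr0 : 0 < Num.min d r0 by rewrite lt_min d0 r00.
  pose K := b * (s * j0) / (e / 2 * (cos 1 * (c / (4 * pi)))).
  have C0 : 0 < cos 1 * (c / (4 * pi)) by rewrite mulr_gt0// divr_gt0// mulr_gt0.
  have D0 : 0 < e / 2 * (cos 1 * (c / (4 * pi))) by rewrite mulr_gt0// divr_gt0.
  have K0 : 0 <= K by rewrite /K !(divr_ge0, mulr_ge0)// ?ltW.
  have KE : K * (e / 2 * (cos 1 * (c / (4 * pi)))) = b * (s * j0).
    by rewrite /K divfK// gt_eqF.
  have i0 : 0 < (pi * Num.min d r0)^-1 by rewrite invr_gt0 mulr_gt0.
  exists ((pi * Num.min d r0)^-1 + K); split; first by rewrite ltr_wpDr.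
    rewrite -[ltRHS]invrK ltf_pV2 ?posrE ?invr_gt0// ?mulr_gt0//; last by rewrite ltr_wpDr.
    have tp0 : 0 <= 2 * pi * K by apply: mulr_ge0 => //; apply: mulr_ge0 => //; exact: ltW.
    rewrite mulrDr; apply: (ltr_wpDr tp0).
    have -> : 2 * pi * (pi * Num.min d r0)^-1 = 2 * (Num.min d r0)^-1.
      by rewrite invfM mulrA mulfK// gt_eqF.
    by rewrite ltr_pMl ?invr_gt0// ltr1n.
  set T := _ + K; have T0 : 0 < T by rewrite ltr_wpDr.
  have simpl_mass (k p t : R) : 0 < p -> 0 < t ->
      k * (t ^+ 2 / 2) * (c * (2 * p * t)^-1) = k * (c / (4 * p)) * t.
    by move=> p0 t0; field; rewrite !gt_eqF.
  rewrite simpl_mass//.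
  rewrite -KE mulrCA [K * _]mulrC ler_pM2l ?divr_gt0// ler_pM2l//.
  by rewrite /T lerDr ltW.
pose P := window_mass psi a d T.
have P0 : 0 < P /\ b * (s * j0) <= e / 2 * P.
  (* [r] is the radius within which [fejer_near0] applies *)
  set r := (2 * pi * T)^-1 in Tr0 TP.
  have pi0 := @pi_gt0 R; have cos0 := @cos1_gt0 R.
  have rT0 : 0 < r by rewrite invr_gt0 !mulr_gt0.
  move: Tr0; rewrite lt_min => /andP[rd rr0].
  have mb (x : R) : measurable (ball a x : set (measurableTypeR R)) by exact: measurable_ball.
  suff Pge : cos 1 * (T ^+ 2 / 2) * (c * r) <= P.
    split; last by rewrite (le_trans TP)// ler_wpM2l// divr_ge0// ltW.
    by apply: lt_le_trans Pge; rewrite !mulr_gt0// divr_gt0// exprn_gt0.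
  have ipsi := locally_integrable_ball a r psi_loc.
  have iP := integrable_window psi_loc a d T.
  have sub : ball a r `<=` ball a d by apply: le_ball; exact: ltW.
  have iPr := integrableS (mb d) (mb r) sub iP.
  apply: (@le_trans _ _ (\int[mu]_(u in ball a r) (psi u * fejer_at a T u))).
    apply: (@le_trans _ _ (\int[mu]_(u in ball a r) (cos 1 * (T ^+ 2 / 2) * psi u))).
      rewrite RintegralZl// ler_wpM2l// ?massa// mulr_ge0// ?(ltW cos0)//.
      by rewrite divr_ge0// sqr_ge0.
    apply: le_Rintegral => //; first exact: (integrableZl (mb r) _ ipsi).
    move=> u; rewrite /ball/= distrC => ur; rewrite mulrC ler_wpM2l ?(ltW (psi_gt0 _))//.
    apply: fejer_near0 => //; rewrite normrM (gtr0_norm (_ : 0 < 2 * pi)) ?mulr_gt0//.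
    move: (ltW ur); rewrite /r -[X in _ <= X]mul1r ler_pdivlMr ?mulr_gt0//.
    by rewrite mulrCA mulrA mulrAC.
  rewrite /P /window_mass [leLHS]Rintegral_mkcond [leRHS]Rintegral_mkcond.
  apply: le_Rintegral => //.
  - by rewrite -restrict_EFin; apply/integrable_restrict => //; rewrite setTI.
  - by rewrite -restrict_EFin; apply/integrable_restrict => //; rewrite setTI.
  move=> u _; rewrite !patchE; case: ifPn => [|_]; rewrite ?inE.
    by move=> /sub ub; rewrite mem_set.
  by case: ifPn => // _; rewrite mulr_ge0 ?fejer_at_ge0// ltW.
case: P0 => P0 sP.
pose j xi := lim ((\int[mu]_u (f (x + u) * psi u * cos (2 * pi * (u - a) * xi))) / G x
  @[x --> +oo]).
pose Lam := \int[mu]_xi (tent T xi * j xi).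
have MG : (\int[mu]_u (f (x + u) * psi u * fejer_at a T u)) / G x @[x --> +oo] --> Lam.
  apply: (@fejer_average_cvg _ _ G a (j0 + 1) T j) => //.
  near=> x.
  have -> : \int[mu]_u `|f (x + u) * psi u| = \int[mu]_u (f (x + u) * psi u).
    by apply: eq_Rintegral => u _; rewrite ger0_norm.
  by near: x; apply: (cvgr_le _ average_cvg); rewrite ltrDl.
have Lam0 : 0 <= Lam.
  rewrite -(cvg_lim (@Rhausdorff R) MG); apply: limr_ge.
    by apply/cvg_ex; exists Lam.
  apply: nearW => x; rewrite divr_ge0// Rintegral_ge0// => u _.
  by rewrite mulr_ge0// fejer_at_ge0.
pose al := expR (- (beta * a)) * Lam / P.
have al0 : 0 <= al by rewrite divr_ge0 ?mulr_ge0 ?expR_ge0// ltW.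
have e20 : 0 < e / 2 by rewrite divr_gt0.
exists al; near=> x.
have Fx1 : f x / G x <= expR (beta * d) * al + e / 2.
  by near: x; exact: ratio_upper.
have Fx2 : expR (- (beta * d)) * (expR (- (beta * a)) * (Lam - s * j0) / P) - e / 2
    <= f x / G x.
  by near: x; exact: ratio_lower.
have sPe : b * (s * j0) / P <= e / 2 by rewrite ler_pdivrMr.
have e1 : expR (- (beta * d)) * (expR (- (beta * a)) * (Lam - s * j0) / P) =
   expR (- (beta * d)) * al - b * (s * j0) / P.
  by rewrite /al /b; ring.
move: Fx2; rewrite e1 => Fx2.
apply/andP; split; nra.
Unshelve. all: by end_near. Qed.

End ratio.

(** * Growth of the averages *)

Section growth.
Context {R : realType}.

(** The one-step bounds are iterated along integers, and monotonicity fills the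
gaps between them at the cost of one extra factor [expR (beta + e)]. *)
Lemma exponential_growth_bound (g : R -> R) (beta e X : R) :
  0 <= beta -> 0 < e ->
  (forall x, X <= x -> 0 < g x) ->
  (forall x y, X <= x -> x <= y -> g x <= g y) ->
  (forall x, X <= x ->
     expR (beta - e) * g x <= g (x + 1) <= expR (beta + e) * g x) ->
  forall x y, X <= x -> X <= y ->
    g y <= expR (beta + e) * expR (beta * (y - x) + e * `|y - x|) * g x.
Proof.
move=> b0 e0 g0 gnd gstep.
have step n x : X <= x ->
    expR ((beta - e) * n%:R) * g x <= g (x + n%:R) <= expR ((beta + e) * n%:R) * g x.
  move=> Xx; elim: n => [|n /andP[IH1 IH2]].
    by rewrite !mulr0 addr0 expR0 mul1r lexx.
  have Xn : X <= x + n%:R by rewrite (le_trans Xx)// lerDl.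
  have /andP[s1 s2] := gstep _ Xn.
  have expRS k : expR (k * n.+1%:R) = expR k * expR (k * n%:R) :> R.
    by rewrite -expRD -natr1; congr expR; ring.
  rewrite !expRS -natr1 addrA -!mulrA; apply/andP; split.
    by apply: le_trans s1; rewrite ler_pM2l ?expR_gt0.
  by apply: (le_trans s2); rewrite ler_pM2l ?expR_gt0.
move=> x y Xx Xy; rewrite -expRD.
have [xy|yx] := leP x y.
  have yx0 : 0 <= y - x by rewrite subr_ge0.
  have /andP[n1 n2] := truncn_itv yx0; set n := Num.truncn _ in n1 n2.
  have /andP[_ s2] := step n.+1 x Xx.
  apply: (le_trans (gnd y (x + n.+1%:R) Xy _)); first by rewrite -lerBlDl ltW.
  apply: (le_trans s2); rewrite ler_wpM2r ?(ltW (g0 _ Xx))// ler_expR (ger0_norm yx0).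
  by rewrite -natr1; nra.
have yx0 : 0 <= x - y by rewrite subr_ge0 ltW.
have /andP[n1 n2] := truncn_itv yx0; set n := Num.truncn _ in n1 n2.
have /andP[s1 _] := step n y Xy.
have gx : expR ((beta - e) * n%:R) * g y <= g x.
  apply: (le_trans s1); apply: gnd; last by rewrite -lerBrDl.
  by rewrite (le_trans Xy)// lerDl.
have -> : g y = expR (- ((beta - e) * n%:R)) * (expR ((beta - e) * n%:R) * g y).
  by rewrite mulrA -expRD addNr expR0 mul1r.
apply: ler_pM => //; rewrite ?expR_ge0 ?mulr_ge0 ?expR_ge0 ?(ltW (g0 _ _))//.
rewrite ler_expR distrC (ger0_norm yx0).
move: n2; rewrite -natr1 => n2; nra.
Qed.

End growth.

Section moment.
Context {R : realType}.
Local Notation mu := (@lebesgue_measure R).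
Variables (f psi G : R -> R) (beta : R).
Hypothesis f_nd : {homo f : x y / x <= y}.
Hypothesis f_ge0 : forall x, 0 <= f x.
Hypothesis psi_gt0 : forall u, 0 < psi u.
Hypothesis psi_loc : locally_integrable setT psi.
Hypothesis G_gt0 : forall x, 0 < G x.
Hypothesis G_shift : forall s, G (x + s) / G x @[x --> +oo] --> expR (beta * s).
Hypothesis f_int : \forall x \near +oo,
  mu.-integrable setT (fun u => (f (x + u) * psi u)%:E).

Definition average (f psi : R -> R) x := \int[mu]_u (f (x + u) * psi u).

Variables j c : R.
Hypothesis average_cvg : average f psi x / G x @[x --> +oo] --> j.
Hypothesis f_cvg : f x / G x @[x --> +oo] --> c.

Lemma limit_ge0 : 0 <= j /\ 0 <= c.
Proof.
split.
  rewrite -(cvg_lim (@Rhausdorff R) average_cvg); apply: limr_ge.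
    by apply/cvg_ex; exists j.
  apply: nearW => x; rewrite divr_ge0// ?Rintegral_ge0//; last exact: ltW.
  by move=> u _; rewrite mulr_ge0// ltW.
rewrite -(cvg_lim (@Rhausdorff R) f_cvg); apply: limr_ge.
  by apply/cvg_ex; exists c.
by apply: nearW => x; rewrite divr_ge0// ltW.
Qed.

(** A small ball around a Lebesgue point [a], translated by [s = r - a] into the
right half-line, shows [f x * M <= average f psi (x + s)] for large [x], [M]
being the mass of [psi] on the ball. *)
Lemma limit_eq0 : j = 0 -> c = 0.
Proof.
move=> jE.
have [a [k [r0 [k0 r00 massa]]]] := positive_mass_near_point psi_loc psi_gt0.
pose r := r0 / 2.
have r_gt0 : 0 < r by rewrite divr_gt0.
have := massa r r_gt0; rewrite /r ltr_pdivrMr// ltr_pMr// ltr1n => /(_ isT) mr.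
set M := \int[mu]_(u in _) _ in mr.
have M0 : 0 < M by apply: lt_le_trans mr; rewrite mulr_gt0.
pose s := r - a.
have up : (average f psi (x + s) / G (x + s)) * (G (x + s) / G x) / M @[x --> +oo] -->
    j * expR (beta * s) / M.
  apply: cvgMl; apply: cvgM; last exact: G_shift.
  exact: (cvg_comp _ _ (cvg_shift_pinfty s) average_cvg).
have [_ c0] := limit_ge0.
apply/eqP; rewrite eq_le c0 andbT.
have -> : 0 = j * expR (beta * s) / M by rewrite jE !mul0r.
rewrite -(cvg_lim (@Rhausdorff R) f_cvg) -(cvg_lim (@Rhausdorff R) up).
apply: ler_lim.
- by apply/cvg_ex; exists c.
- by apply/cvg_ex; exists (j * expR (beta * s) / M).
near=> x.
rewrite mulrA divfK ?gt_eqF// mulrAC ler_pM2r ?invr_gt0// ler_pdivlMr// /M.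
have mb : measurable (ball a r : set (measurableTypeR R)) by exact: measurable_ball.
have ib := locally_integrable_ball a r psi_loc.
have ix : mu.-integrable setT (EFin \o (fun u => f (x + s + u) * psi u)).
  by near: x; exact: (near_pinfty_shift s f_int).
rewrite -RintegralZl// /average [leLHS]Rintegral_mkcond.
apply: le_Rintegral => //.
  rewrite -restrict_EFin; apply/integrable_restrict => //; rewrite setTI.
  exact: (integrableZl mb _ ib).
move=> u _; rewrite patchE; case: ifPn => [|_]; last by rewrite mulr_ge0// ltW.
rewrite inE /ball/= ltr_norml => /andP[u1 u2].
rewrite ler_wpM2r ?(ltW (psi_gt0 _))//; apply: f_nd.
by move: u1 u2; rewrite /s /r; lra.
Unshelve. all: by end_near. Qed.

Lemma average_nondecreasing : exists X, forall x y, X <= x -> x <= y ->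
  average f psi x <= average f psi y.
Proof.
have [X [_ HX]] := f_int.
exists (X + 1) => x y Xx xy; apply: le_Rintegral => //.
- by apply: HX; lra.
- by apply: HX; lra.
- by move=> u _; rewrite ler_wpM2r ?(ltW (psi_gt0 _))//; apply: f_nd; lra.
Qed.

Lemma average_shift s : 0 < j ->
  average f psi (x + s) / average f psi x @[x --> +oo] --> expR (beta * s).
Proof.
move=> j0.
have : (average f psi (x + s) / G (x + s)) * (average f psi x / G x)^-1 * (G (x + s) / G x)
    @[x --> +oo] --> j * j^-1 * expR (beta * s).
  apply: cvgM; last exact: G_shift.
  apply: cvgM; first exact: (cvg_comp _ _ (cvg_shift_pinfty s) average_cvg).
  by apply: cvgV => //; rewrite gt_eqF.
rewrite divff ?gt_eqF// mul1r; apply: cvg_trans; apply: near_eq_cvg; near=> x.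
have : 0 < average f psi x / G x by near: x; exact: (cvgr_gt _ average_cvg).
rewrite pmulr_lgt0 ?invr_gt0// => I0.
by field; rewrite !gt_eqF.
Unshelve. all: by end_near. Qed.

End moment.

(** * The limit under exponential integrability *)

Section moment_limit.
Context {R : realType}.
Local Notation mu := (@lebesgue_measure R).
Variables (f psi G : R -> R) (beta : R).
Hypothesis f_nd : {homo f : x y / x <= y}.
Hypothesis f_ge0 : forall x, 0 <= f x.
Hypothesis f_neg : forall x, x < 0 -> f x = 0.
Hypothesis psi_gt0 : forall u, 0 < psi u.
Hypothesis psi_loc : locally_integrable setT psi.
Hypothesis beta_ge0 : 0 <= beta.
Hypothesis G_gt0 : forall x, 0 < G x.
Hypothesis G_shift : forall s, G (x + s) / G x @[x --> +oo] --> expR (beta * s).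
Hypothesis f_int : \forall x \near +oo,
  mu.-integrable setT (fun u => (f (x + u) * psi u)%:E).
Variables j c : R.
Hypothesis average_cvg : average f psi x / G x @[x --> +oo] --> j.
Hypothesis f_cvg : f x / G x @[x --> +oo] --> c.

Lemma average_eventually : 0 < j -> exists X K, [/\ 0 <= X, 0 < K,
  (forall x, X <= x -> [/\ j / 2 * G x <= average f psi x,
     average f psi x <= 2 * j * G x, 0 < average f psi x & f x <= K * average f psi x]) &
  (forall x y, X <= x -> x <= y -> average f psi x <= average f psi y)].
Proof.
move=> j0.
have [_ c0] := limit_ge0 f_ge0 psi_gt0 G_gt0 average_cvg f_cvg.
have [X0 nd] := average_nondecreasing f_nd psi_gt0 f_int.
have : \forall x \near +oo, [/\ X0 <= x, 0 <= x, j / 2 * G x <= average f psi x,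
     average f psi x <= 2 * j * G x & f x <= (c + 1) * G x].
  near=> x; split.
  - by near: x; apply: nbhs_pinfty_ge; exact: num_real.
  - by near: x; apply: nbhs_pinfty_ge; exact: num_real.
  - rewrite -ler_pdivlMr//; near: x; apply: (cvgr_ge _ average_cvg).
    by rewrite ltr_pdivrMr// ltr_pMr// ltr1n.
  - rewrite -ler_pdivrMr//; near: x; apply: (cvgr_le _ average_cvg).
    by rewrite ltr_pMl// ltr1n.
  - rewrite -ler_pdivrMr//; near: x; apply: (cvgr_le _ f_cvg).
    by rewrite ltrDl.
move=> [X [_ HX]].
have {}HX x : `|X| + 1 <= x -> [/\ X0 <= x, 0 <= x, j / 2 * G x <= average f psi x,
     average f psi x <= 2 * j * G x & f x <= (c + 1) * G x].
  by move=> Xx; apply: HX; rewrite (lt_le_trans _ Xx)// ltr_pwDr// ler_norm.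
exists (`|X| + 1), ((c + 1) * (2 / j)); split.
- by rewrite addr_ge0.
- by rewrite mulr_gt0 ?divr_gt0// ltr_wpDl.
- move=> x /HX[_ _ I1 I2 fx]; split => //.
    by apply: lt_le_trans I1; rewrite mulr_gt0// divr_gt0.
  apply: (le_trans fx); rewrite -mulrA ler_wpM2l ?addr_ge0//.
  by rewrite mulrAC ler_pdivlMr//; move: I1; lra.
- by move=> x y /HX[Xx _ _ _ _]; exact: nd.
Unshelve. all: by end_near. Qed.

(** Pointwise, [f (x + u) / G x] splits as [f (x + u) / G (x + u)] times
[G (x + u) / G x]; only the majorant [Phi] changes from one application to
another. *)
Lemma dominated_average (D : set R) (Phi : R -> R) :
  measurable (D : set (measurableTypeR R)) ->
  (\forall x \near +oo, forall u, D u -> f (x + u) <= Phi u * G x) ->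
  mu.-integrable D (fun u => (Phi u * psi u)%:E) ->
  mu.-integrable D (fun u => (c * (psi u * expR (beta * u)))%:E) /\
  (\int[mu]_(u in D) (f (x + u) * psi u)) / G x @[x --> +oo] -->
    \int[mu]_(u in D) (c * (psi u * expR (beta * u))).
Proof.
move=> mD fPhi iPhi.
have mpsi : measurable_fun setT psi by case: psi_loc.
have [] := @dominated_cvg_pinfty _ D (fun x u => f (x + u) * psi u / G x)
  (fun u => c * (psi u * expR (beta * u))) (fun u => Phi u * psi u) mD _ _ iPhi _.
- near=> x.
  have ix : mu.-integrable setT (fun u => (f (x + u) * psi u)%:E) by near: x.
  apply: measurable_funM => //; apply: measurable_funTS.
  by case/integrableP : ix => /measurable_EFinP.
- move=> u _.
  have : (f (x + u) / G (x + u)) * (G (x + u) / G x) * psi u @[x --> +oo] -->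
      c * expR (beta * u) * psi u.
    apply: cvgMl; apply: cvgM; last exact: G_shift.
    exact: (cvg_comp _ _ (cvg_shift_pinfty u) f_cvg).
  rewrite -mulrA [expR _ * _]mulrC; apply: cvg_trans; apply: near_eq_cvg; near=> x.
  by field; rewrite !gt_eqF.
- near=> x => u Du.
  rewrite ger0_norm; last by rewrite divr_ge0 ?mulr_ge0// ltW.
  rewrite ler_pdivrMr// mulrAC ler_wpM2r ?(ltW (psi_gt0 _))//.
  by move: u Du; near: x.
move=> ic H; split => //; apply: cvg_trans H; apply: near_eq_cvg; near=> x.
have ix : mu.-integrable setT (fun u => (f (x + u) * psi u)%:E) by near: x.
by rewrite (RintegralZr _ mD (integrableS measurableT mD (@subsetT _ _) ix)).
Unshelve. all: by end_near. Qed.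

(** As [f (x + u)] is at most a multiple of [average f psi] at the larger of [Y]
and [x + u], the growth bound for the averages gives the majorant; replacing
[x + u] by [Y] costs the factor [expR ((beta + e) * Y)]. *)
Lemma moment_of_exponential_tail e : 0 < e -> 0 < j ->
  mu.-integrable setT (fun u => (psi u * expR (beta * u + e * `|u|))%:E) ->
  j = \int[mu]_u (c * (psi u * expR (beta * u))).
Proof.
move=> e0 j0 iE.
have [X [K [X0 K0 HX nd]]] := average_eventually j0.
have sh := average_shift (s := 1) G_gt0 G_shift average_cvg j0.
have [Y [XY stepY]] : exists Y, X <= Y /\ forall x, Y <= x ->
    expR (beta - e) * average f psi x <= average f psi (x + 1)
      <= expR (beta + e) * average f psi x.
  have : \forall x \near +oo, [/\ X <= x,
      expR (beta - e) <= average f psi (x + 1) / average f psi x &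
      average f psi (x + 1) / average f psi x <= expR (beta + e)].
    near=> x; split.
    - by near: x; apply: nbhs_pinfty_ge; exact: num_real.
    - near: x; apply: (cvgr_ge _ sh); rewrite ltr_expR; lra.
    - near: x; apply: (cvgr_le _ sh); rewrite ltr_expR; lra.
  move=> [Y [_ HY]]; exists (Num.max X (Y + 1)); split; first by rewrite le_max lexx.
  move=> x; rewrite ge_max => /andP[_ Yx].
  have [|Xx l1 l2] := HY x; first by lra.
  have [_ _ I0 _] := HX _ Xx.
  by apply/andP; split; [rewrite -ler_pdivlMr|rewrite -ler_pdivrMr].
have pos x : Y <= x -> 0 < average f psi x.
  by move=> Yx; have [] := HX x (le_trans XY Yx).
have ndY x y : Y <= x -> x <= y -> average f psi x <= average f psi y.
  by move=> Yx; apply: nd; exact: le_trans Yx.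
have gb := exponential_growth_bound beta_ge0 e0 pos ndY stepY.
pose C := K * (expR (beta + e) * expR ((beta + e) * Y)).
pose Phi u := C * expR (beta * u + e * `|u|) * (2 * j).
have Y0 : 0 <= Y by exact: le_trans XY.
have [] := @dominated_average setT Phi measurableT.
- near=> x => u _.
  have Yx : Y <= x by near: x; apply: nbhs_pinfty_ge; exact: num_real.
  have [_ IG I0 _] := HX x (le_trans XY Yx).
  have -> : Phi u * G x = C * expR (beta * u + e * `|u|) * (2 * j * G x).
    by rewrite /Phi -!mulrA.
  apply: le_trans (_ : C * expR (beta * u + e * `|u|) * average f psi x <= _); last first.
    by rewrite ler_wpM2l// !mulr_ge0 ?expR_ge0// ltW.
  have [xu0|xu0] := ltP (x + u) 0.
    by rewrite f_neg// !mulr_ge0 ?expR_ge0// ltW.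
  pose y := Num.max Y (x + u).
  have Yy : Y <= y by rewrite le_max lexx.
  have [_ _ _ fy] := HX y (le_trans XY Yy).
  apply: (@le_trans _ _ (f y)); first by apply: f_nd; rewrite le_max lexx orbT.
  apply: (le_trans fy); rewrite /C -!mulrA ler_wpM2l ?(ltW K0)//.
  apply: (le_trans (gb _ _ Yx Yy)); rewrite -!mulrA ler_wpM2l ?expR_ge0//.
  rewrite mulrA -expRD ler_wpM2r ?(ltW I0)// ler_expR.
  have : y - x <= u + Y /\ `|y - x| <= `|u| + Y.
    rewrite /y maxEle; case: ifPn => [_|]; last first.
      rewrite -ltNge => xuY; split; first lra.
      rewrite ler_norml; have := ler_norm (- u); rewrite normrN => nu.
      by have := normr_ge0 u => ?; apply/andP; split; lra.
    by rewrite addrAC subrr add0r; split; rewrite lerDl.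
  move=> [yx1 yx2].
  have : beta * (y - x) <= beta * (u + Y) by rewrite ler_wpM2l.
  have : e * `|y - x| <= e * (`|u| + Y) by rewrite ler_wpM2l// ltW.
  by lra.
- apply: eq_integrable (integrableZl measurableT (C * (2 * j)) iE) => // u _.
  by rewrite /Phi -EFinM; congr EFin; ring.
move=> _ H; apply: cvg_unique average_cvg H => //.
Unshelve. all: by end_near. Qed.

End moment_limit.

(** * The limit under submultiplicativity *)

Section submultiplicative.
Context {R : realType}.
Local Notation mu := (@lebesgue_measure R).
Variables (f psi lam : R -> R) (beta : R).
Hypothesis f_nd : {homo f : x y / x <= y}.
Hypothesis f_ge0 : forall x, 0 <= f x.
Hypothesis f_neg : forall x, x < 0 -> f x = 0.
Hypothesis psi_gt0 : forall u, 0 < psi u.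
Hypothesis psi_loc : locally_integrable setT psi.
Hypothesis beta_ge0 : 0 <= beta.
Hypothesis lam_gt0 : forall x, 0 < lam x.
Let G x := expR (beta * x) * lam x.
Hypothesis G_shift : forall s, G (x + s) / G x @[x --> +oo] --> expR (beta * s).
Hypothesis f_int : \forall x \near +oo,
  mu.-integrable setT (fun u => (f (x + u) * psi u)%:E).
Variables j c : R.
Hypothesis average_cvg : average f psi x / G x @[x --> +oo] --> j.
Hypothesis f_cvg : f x / G x @[x --> +oo] --> c.
Hypothesis j_gt0 : 0 < j.
Variable A : R.
Hypothesis lam_sub : forall x y, lam (x + y) <= A * lam x * lam y.
Hypothesis lam_int : (\int[mu]_u (psi u * lam `|u| * expR (beta * u))%:E < +oo)%E.

Let G_gt0 x : 0 < G x. Proof. by rewrite mulr_gt0 ?expR_gt0. Qed.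

Let mpsi : measurable_fun setT psi. Proof. by case: psi_loc. Qed.

Lemma submultiplicative_const_gt0 : 0 < A.
Proof.
have := lam_sub 0 0; rewrite addr0 => l0.
by have := lam_gt0 0; have := lt_le_trans (lam_gt0 0) l0; rewrite !pmulr_lgt0.
Qed.

(** Dividing [lam (x + s) <= A * lam x * lam s] by [lam x] and letting [x] tend to
infinity. *)
Lemma submultiplicative_lower s : 1 <= A * lam s.
Proof.
have A0 := submultiplicative_const_gt0.
suff : expR (beta * s) <= expR (beta * s) * (A * lam s).
  by rewrite ler_pMr ?expR_gt0.
rewrite -[leLHS](cvg_lim (@Rhausdorff R) (@G_shift s)).
apply: limr_le; first by apply/cvg_ex; eexists; exact: (@G_shift s).
apply: nearW => x; rewrite ler_pdivrMr// /G mulrDr expRD.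
have := lam_sub x s; have := expR_gt0 (beta * x); have := expR_gt0 (beta * s).
move=> e1 e2 sub.
have -> : expR (beta * s) * (A * lam s) * (expR (beta * x) * lam x) =
  expR (beta * x) * expR (beta * s) * (A * lam x * lam s) by ring.
by rewrite ler_wpM2l// mulr_ge0// ltW.
Qed.

Lemma integrable_moment : mu.-integrable setT (fun u => (psi u * expR (beta * u))%:E).
Proof.
apply: (@integrable_le_lower _ _ _ (fun u => psi u * lam `|u| * expR (beta * u)) A) => //.
- by apply: measurable_funM => //; exact: measurable_expR_linear.
- by move=> u; rewrite !mulr_ge0 ?expR_ge0// ltW.
- move=> u _; rewrite mulr_ge0 ?expR_ge0 ?(ltW (psi_gt0 _))//=.
  have -> : A * (psi u * lam `|u| * expR (beta * u)) =
    psi u * (expR (beta * u) * (A * lam `|u|)) by ring.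
  rewrite ler_wpM2l ?(ltW (psi_gt0 _))// ler_peMr ?expR_ge0//.
  exact: submultiplicative_lower.
Qed.

(** [Phi u] is a multiple of the supremum over [x >= X] of the ratios
[average f psi (x + u) / average f psi x], with [u] replaced by 0 when it is
negative.  The averages are monotone, hence so is the supremum, which makes it
Borel measurable although [lam] itself may fail to be. *)
Lemma growth_majorant : exists Phi X K, [/\ 0 < K, {homo Phi : x y / x <= y},
  (forall u, 0 <= u -> Phi u <= K * (expR (beta * u) * lam u)),
  (forall u, u <= 0 -> Phi u <= K) &
  (forall x u, X <= x -> 0 <= Phi u /\ f (x + u) <= Phi u * G x)].
Proof.
have A0 := submultiplicative_const_gt0.
have [X [K [X0 K0 HX nd]]] :=
  average_eventually f_nd f_ge0 psi_gt0 G_gt0 f_int average_cvg f_cvg j_gt0.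
pose I := average f psi.
(* the ratios whose supremum is [Phi u] up to a constant *)
pose S u := [set I (x + Num.max u 0) / I x | x in [set x | X <= x]].
have I0 x : X <= x -> 0 < I x by move=> /HX[].
have mx (u : R) : 0 <= Num.max u 0 by rewrite le_max lexx orbT.
have Sub u : ubound (S u) (4 * A * (expR (beta * Num.max u 0) * lam (Num.max u 0))).
  move=> _ [x /= Xx <-]; set v := Num.max u 0.
  have [l1 _ Ix _] := HX x Xx.
  have Xv : X <= x + v by rewrite (le_trans Xx)// lerDl mx.
  have [_ l2 _ _] := HX _ Xv.
  rewrite ler_pdivrMr// /I (le_trans l2)//.
  have sub : G (x + v) <= A * (expR (beta * v) * lam v) * G x.
    rewrite /G mulrDr expRD.
    have -> : A * (expR (beta * v) * lam v) * (expR (beta * x) * lam x) =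
      expR (beta * x) * expR (beta * v) * (A * lam x * lam v) by ring.
    by rewrite ler_wpM2l// mulr_ge0// expR_ge0.
  have -> : 4 * A * (expR (beta * v) * lam v) * average f psi x =
    4 * (A * (expR (beta * v) * lam v)) * average f psi x by ring.
  apply: (le_trans (ler_wpM2l _ sub)); first by rewrite mulr_ge0// ltW.
  set E := A * _.
  have E0 : 0 <= E by rewrite !mulr_ge0 ?expR_ge0// ltW.
  have : E * (j / 2 * G x) <= E * average f psi x by rewrite ler_wpM2l.
  lra.
have Shas u : has_sup (S u).
  split; first by exists (I (X + Num.max u 0) / I X); exists X => /=.
  by eexists; exact: Sub.
have Sle u x : X <= x -> I (x + Num.max u 0) / I x <= sup (S u).
  by move=> Xx; apply: sup_upper_bound => //; exists x.
have S1 u : 1 <= sup (S u).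
  apply: le_trans (Sle u X (lexx _)); rewrite ler_pdivlMr ?I0// mul1r.
  by apply: nd => //; rewrite lerDl.
exists (fun u => 2 * j * K * sup (S u)), X, (2 * j * K * (4 * A + 1)).
have JK : 0 < 2 * j * K by rewrite !mulr_gt0.
split.
- by rewrite !mulr_gt0// ltr_wpDl// mulr_ge0// ltW.
- move=> u v uv; rewrite ler_wpM2l ?(ltW JK)//.
  apply: sup_le_ub; first by have [] := Shas u.
  move=> _ [x /= Xx <-]; apply: le_trans (Sle v x Xx).
  rewrite ler_wpM2r ?invr_ge0 ?(ltW (I0 _ _))//; apply: nd.
    by rewrite (le_trans Xx)// lerDl.
  by rewrite lerD2l ge_max !le_max uv lexx orbT.
- move=> u u0; rewrite -[leRHS]mulrA ler_wpM2l ?(ltW JK)//.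
  have u0' : Num.max u 0 = u by apply/max_idPl.
  have l0 : 0 < expR (beta * u) * lam u by rewrite mulr_gt0 ?expR_gt0.
  apply: sup_le_ub; first by have [] := Shas u.
  move=> y /Sub; rewrite u0' => /le_trans; apply.
  by rewrite ler_wpM2r ?(ltW l0)// lerDl.
- move=> u u0; rewrite ler_wpM2l ?(ltW JK)//.
  have u0' : Num.max u 0 = 0 by apply/max_idPr.
  apply: sup_le_ub; first by have [] := Shas u.
  move=> _ [x /= Xx <-]; rewrite u0' addr0 divff ?gt_eqF ?I0//.
  by rewrite lerDr mulr_ge0// ltW.
- move=> x u Xx; split.
    by rewrite mulr_ge0 ?(ltW JK)// (le_trans ler01)//.
  have Xm : X <= x + Num.max u 0 by rewrite (le_trans Xx)// lerDl.
  have [_ l2 Ix _] := HX x Xx; have [_ _ _ l3] := HX _ Xm.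
  apply: (@le_trans _ _ (f (x + Num.max u 0))).
    by apply: f_nd; rewrite lerD2l le_max lexx.
  apply: (le_trans l3).
  have := Sle u x Xx; rewrite ler_pdivrMr// => l4.
  have s0 := le_trans ler01 (S1 u).
  apply: (@le_trans _ _ (K * (sup (S u) * (2 * j * G x)))).
    by rewrite ler_wpM2l ?(ltW K0)// (le_trans l4)// ler_wpM2l.
  by rewrite le_eqVlt; apply/orP; left; apply/eqP; ring.
Qed.

Let p u := psi u * expR (beta * u).

Let p_ge0 u : 0 <= p u. Proof. by rewrite mulr_ge0 ?expR_ge0// ltW. Qed.

Let ray V : set R := `]-oo, (- V)[%classic.

Let coray V : set R := `[(- V), +oo[%classic.

Let mray V : measurable (ray V : set (measurableTypeR R)).
Proof. exact: measurable_itv. Qed.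

Let mcoray V : measurable (coray V : set (measurableTypeR R)).
Proof. exact: measurable_itv. Qed.

Let split_ray V (h : R -> R) : mu.-integrable setT (EFin \o h) ->
  \int[mu]_u h u = \int[mu]_(u in ray V) h u + \int[mu]_(u in coray V) h u.
Proof.
move=> ih; have T : ray V `|` coray V = setT.
  by rewrite /ray /coray -setCitvl setUv.
rewrite -T Rintegral_setU//; first by rewrite T.
rewrite disj_set2E; apply/eqP; rewrite /ray /coray -setCitvl; exact: setICr.
Qed.

Let q V := \int[mu]_(u in ray V) p u.

Let q_cvg0 : q V @[V --> +oo] --> 0.
Proof.
have [] := @dominated_cvg_pinfty _ setT (fun V u => (p \_ (ray V)) u) (cst 0) p
  measurableT _ _ integrable_moment _.
- apply: nearW => V; apply/(measurable_restrictT _ (mray V)).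
  apply: measurable_funTS.
  by have /integrableP[/measurable_EFinP] := integrable_moment.
- move=> u _; apply: cvg_near_cst; near=> V.
  rewrite patchE; case: ifPn => //; rewrite inE /ray/= in_itv/= => uV.
  have : - u < V by near: V; apply: nbhs_pinfty_gt; exact: num_real.
  by move: uV; lra.
- apply: nearW => V u _; rewrite patchE; case: ifPn => _; last by rewrite normr0.
  by rewrite ger0_norm.
move=> _; rewrite /= Rintegral_cst// mul0r.
by apply: cvg_trans; apply: near_eq_cvg; apply: nearW => V; rewrite /q Rintegral_mkcond.
Unshelve. all: by end_near. Qed.

(** On [u >= - V] the majorant is controlled by [psi u * lam |u| * expR (beta * u)]
also for negative [u], since there [expR (beta * (V + u)) >= 1] and
[A * lam |u| >= 1]. *)
Lemma near_part_cvg V : 0 <= V ->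
  (\int[mu]_(u in coray V) (f (x + u) * psi u)) / G x @[x --> +oo] -->
  c * (\int[mu]_u p u - q V).
Proof.
move=> V0.
have A0 := submultiplicative_const_gt0.
have [Phi [X [K [K0 Phi_nd Phi_pos Phi_neg fPhi]]]] := growth_majorant.
have mPhi : measurable_fun setT (Phi : R -> R) by exact: nondecreasing_measurable.
have iPhi : mu.-integrable (coray V) (fun u => (Phi u * psi u)%:E).
  apply: (@integrable_le_lower _ _ _ (fun u => psi u * lam `|u| * expR (beta * u))
    (K * (1 + A * expR (beta * V)))) => //.
  - by apply: measurable_funTS; exact: measurable_funM.
  - by move=> u; rewrite !mulr_ge0 ?expR_ge0// ltW.
  - move=> u; rewrite /coray/= in_itv/= andbT => uV.
    have [Phi0 _] := fPhi X u (lexx _).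
    rewrite mulr_ge0 ?(ltW (psi_gt0 _))//=.
    have k0 : 0 <= psi u * lam `|u| * expR (beta * u).
      by rewrite !mulr_ge0 ?expR_ge0// ltW.
    have [u0|/ltW u0] := leP 0 u.
      apply: (@le_trans _ _ (K * (psi u * lam `|u| * expR (beta * u)))); last first.
        rewrite ler_wpM2r// ler_peMr ?(ltW K0)// lerDl.
        by rewrite mulr_ge0 ?expR_ge0// ltW.
      rewrite (ger0_norm u0).
      apply: (le_trans (ler_wpM2r (ltW (psi_gt0 u)) (Phi_pos u u0))).
      by rewrite le_eqVlt; apply/orP; left; apply/eqP; ring.
    apply: (le_trans (ler_wpM2r (ltW (psi_gt0 u)) (Phi_neg u u0))).
    rewrite -[leRHS]mulrA ler_wpM2l ?(ltW K0)//.
    apply: (@le_trans _ _ (A * expR (beta * V) * (psi u * lam `|u| * expR (beta * u)))); last first.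
      by rewrite ler_wpM2r// lerDr.
    have -> : A * expR (beta * V) * (psi u * lam `|u| * expR (beta * u)) =
      psi u * ((A * lam `|u|) * expR (beta * (V + u))) by rewrite mulrDr expRD; ring.
    rewrite ler_peMr ?(ltW (psi_gt0 _))//.
    have e1 : 1 <= expR (beta * (V + u)).
      by rewrite -expR0 ler_expR mulr_ge0//; move: uV; lra.
    have A1 := submultiplicative_lower `|u|.
    by rewrite (le_trans A1)// ler_peMr// (le_trans ler01).
have [|_] := dominated_average f_ge0 psi_gt0 psi_loc G_gt0 G_shift f_int f_cvg (mcoray V) _ iPhi.
  near=> x => u _.
  have Xx : X <= x by near: x; apply: nbhs_pinfty_ge; exact: num_real.
  by have [] := fPhi x u Xx.
have ip := integrableS measurableT (mcoray V) (@subsetT _ _) integrable_moment.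
rewrite (RintegralZl _ (mcoray V) ip).
by rewrite (split_ray V integrable_moment) /q addrC addKr.
Unshelve. all: by end_near. Qed.

(** The mass lost at minus infinity; the goal is to show that it vanishes. *)
Let l := j - c * \int[mu]_u p u.

Let tail V x := \int[mu]_(u in ray V) (f (x + u) * psi u).

Lemma tail_cvg V : 0 <= V -> tail V x / G x @[x --> +oo] --> l + c * q V.
Proof.
move=> V0.
have -> : l + c * q V = j - c * (\int[mu]_u p u - q V) by rewrite /l; ring.
have : average f psi x / G x - (\int[mu]_(u in coray V) (f (x + u) * psi u)) / G x
    @[x --> +oo] --> j - c * (\int[mu]_u p u - q V).
  by apply: cvgB; [exact: average_cvg|exact: near_part_cvg].
apply: cvg_trans; apply: near_eq_cvg; near=> x.
have ix : mu.-integrable setT (fun u => (f (x + u) * psi u)%:E) by near: x.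
by rewrite /average (split_ray V ix) -mulrBl addrK.
Unshelve. all: by end_near. Qed.

Lemma tail_upper V x B :
  mu.-integrable setT (fun u => (f (x + u) * psi u)%:E) ->
  (forall y, y <= x - V -> f y <= B * expR (beta * y)) ->
  tail V x <= B * expR (beta * x) * q V.
Proof.
move=> ix fB.
have ip := integrableS measurableT (mray V) (@subsetT _ _) integrable_moment.
rewrite /q -(RintegralZl _ (mray V) ip); apply: le_Rintegral => //.
- exact: (integrableS measurableT (mray V) (@subsetT _ _) ix).
- exact: (integrableZl (mray V) _ ip).
move=> u; rewrite /ray/= in_itv/= => uV.
have -> : B * expR (beta * x) * (psi u * expR (beta * u)) =
  B * expR (beta * (x + u)) * psi u by rewrite mulrDr expRD; ring.
by rewrite ler_wpM2r ?(ltW (psi_gt0 _))// fB//; move: uV; lra.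
Qed.

Let q_ge0 V : 0 <= q V. Proof. exact: Rintegral_ge0. Qed.

Let l_ge0 : 0 <= l.
Proof.
have : l + c * q V @[V --> +oo] --> l + c * 0.
  by apply: cvgD; [exact: cvg_cst|apply: cvgMr; exact: q_cvg0].
rewrite mulr0 addr0 => lq.
rewrite -(cvg_lim (@Rhausdorff R) lq); apply: limr_ge; first by apply/cvg_ex; exists l.
near=> V.
have V0 : 0 <= V by near: V; apply: nbhs_pinfty_ge; exact: num_real.
rewrite -(cvg_lim (@Rhausdorff R) (tail_cvg V0)); apply: limr_ge.
  by apply/cvg_ex; exists (l + c * q V); exact: tail_cvg.
apply: nearW => x; rewrite divr_ge0// ?(ltW (G_gt0 _))// Rintegral_ge0// => u _.
by rewrite mulr_ge0// ltW.
Unshelve. all: by end_near. Qed.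

(** If [l > 0], the mass below [- V] is at least [l / 2] of [G x] for large [x], and
at most [B * expR (beta * x) * q V] when [f y <= B * expR (beta * y)] below
[x - V].  A first choice of [V] propagates such a bound with constant
[B0 = f X1] from [y <= X1] to the whole line; a second one contradicts
[A * lam >= 1]. *)
Lemma moment_of_submultiplicative : j = \int[mu]_u (c * p u).
Proof.
have A0 := submultiplicative_const_gt0.
have [_ c0] := limit_ge0 f_ge0 psi_gt0 G_gt0 average_cvg f_cvg.
rewrite (RintegralZl _ measurableT integrable_moment).
apply/eqP; rewrite -subr_eq0 eq_le l_ge0 andbT leNgt; apply/negP => l0.
have half V : 0 <= V -> \forall x \near +oo, l / 2 * G x <= tail V x.
  move=> V0; near=> x; rewrite -ler_pdivlMr//; near: x; apply: (cvgr_ge _ (tail_cvg V0)).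
  have : 0 <= c * q V by rewrite mulr_ge0.
  have : 0 < l by [].
  lra.
have bound V x B : l / 2 * G x <= tail V x ->
    mu.-integrable setT (fun u => (f (x + u) * psi u)%:E) ->
    (forall y, y <= x - V -> f y <= B * expR (beta * y)) ->
    l / 2 * lam x <= B * q V.
  move=> lx ix fB; rewrite -(ler_pM2l (expR_gt0 (beta * x))).
  have -> : expR (beta * x) * (l / 2 * lam x) = l / 2 * G x by rewrite /G; ring.
  apply: (le_trans lx); apply: (le_trans (tail_upper ix fB)).
  by rewrite -mulrA mulrCA.
have [V1 [V1ge qV1]] : exists V, 1 <= V /\ (c + 1) * q V <= l / 2.
  suff : \forall V \near +oo, 1 <= V /\ (c + 1) * q V <= l / 2 by exact: filter_ex.
  near=> V; split; first by near: V; apply: nbhs_pinfty_ge; exact: num_real.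
  rewrite mulrC -ler_pdivlMr ?ltr_wpDl//; near: V; apply: (cvgr_le _ q_cvg0).
  by rewrite !divr_gt0// ltr_wpDl.
have [X1 HX1] : exists X1, forall x, X1 <= x ->
    [/\ 0 <= x, f x <= (c + 1) * G x & forall B,
      (forall y, y <= x - V1 -> f y <= B * expR (beta * y)) -> l / 2 * lam x <= B * q V1].
  have : \forall x \near +oo, [/\ 0 <= x, f x <= (c + 1) * G x & forall B,
      (forall y, y <= x - V1 -> f y <= B * expR (beta * y)) -> l / 2 * lam x <= B * q V1].
    near=> x; split.
    - by near: x; apply: nbhs_pinfty_ge; exact: num_real.
    - rewrite -ler_pdivrMr//; near: x; apply: (cvgr_le _ f_cvg).
      by rewrite ltrDl.
    - move=> B; apply: bound; last by near: x.
      by near: x; apply: half; rewrite (le_trans ler01).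
  move=> [X [_ HX]]; exists (X + 1) => x Xx; apply: HX; lra.
pose B0 := f X1.
(* each step extends the bound by 1, as [V1 >= 1] *)
have fB n y : y <= X1 + n%:R -> f y <= B0 * expR (beta * y).
  elim: n y => [|n IH] y.
    rewrite addr0 => yX1; have [y0|y0] := ltP y 0.
      by rewrite f_neg// mulr_ge0 ?expR_ge0// f_ge0.
    apply: (le_trans (f_nd yX1)); rewrite ler_peMr ?f_ge0//.
    by rewrite -expR0 ler_expR mulr_ge0.
  rewrite -natr1 => yn; have [/IH//|ny] := leP y (X1 + n%:R).
  have X1y : X1 <= y by rewrite (le_trans _ (ltW ny))// lerDl.
  have [_ fy /(_ B0) bd] := HX1 y X1y.
  have /bd lamy : forall z, z <= y - V1 -> f z <= B0 * expR (beta * z).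
    by move=> z zy; apply: IH; lra.
  have B00 : 0 <= B0 by exact: f_ge0.
  apply: (le_trans fy); rewrite /G mulrCA mulrC ler_wpM2r ?expR_ge0//.
  rewrite -(ler_pM2l (_ : 0 < l / 2)) ?divr_gt0// mulrCA.
  apply: (le_trans (ler_wpM2l _ lamy)); first by rewrite addr_ge0.
  by rewrite mulrCA [leRHS]mulrC ler_wpM2l.
have fB' y : f y <= B0 * expR (beta * y).
  have [n /ltW yn] : exists n : nat, y - X1 < n%:R.
    by exists (Num.truncn `|y - X1|).+1; rewrite (le_lt_trans (ler_norm _))// truncnS_gt.
  by apply: (fB n); rewrite -lerBlDl.
have B00 : 0 <= B0 by exact: f_ge0.
have [V [V0 qV]] : exists V, 0 <= V /\ (B0 + 1) * q V < l / 2 / A.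
  suff : \forall V \near +oo, 0 <= V /\ (B0 + 1) * q V < l / 2 / A by exact: filter_ex.
  near=> V; split; first by near: V; apply: nbhs_pinfty_ge; exact: num_real.
  rewrite mulrC -ltr_pdivlMr ?ltr_wpDl//; near: V; apply: (cvgr_lt _ q_cvg0).
  by rewrite !divr_gt0// ltr_wpDl.
have [x [lx ix]] : exists x, l / 2 * G x <= tail V x /\
    mu.-integrable setT (fun u => (f (x + u) * psi u)%:E).
  suff : \forall x \near +oo, l / 2 * G x <= tail V x /\
    mu.-integrable setT (fun u => (f (x + u) * psi u)%:E) by exact: filter_ex.
  by near=> x; split; near: x; [exact: half|exact: f_int].
have := bound V x B0 lx ix (fun y _ => fB' y).
apply/negP; rewrite -ltNge.
apply: (@le_lt_trans _ _ ((B0 + 1) * q V)); first by rewrite ler_wpM2r// lerDl.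
apply: (lt_le_trans qV); rewrite ler_wpM2l ?divr_ge0 ?(ltW l0)//.
by rewrite -(ler_pM2l A0) divff ?gt_eqF// submultiplicative_lower.
Unshelve. all: by end_near. Qed.

End submultiplicative.

(** * From complex to real integrals *)

Local Open Scope complex_scope.

Section complex_limits.
Context {R : realType}.
Implicit Types (F : R -> R[i]) (z w : R[i]).

Lemma cvg_ReM F w z : F x @[x --> +oo] --> (z : R[i]^o) ->
  complex.Re (w * F x) @[x --> +oo] --> complex.Re (w * z).
Proof.
move=> Fz; have {}Fz : w * F x @[x --> +oo] --> (w * z : R[i]^o).
  by apply: cvgM; [exact: cvg_cst|exact: Fz].
apply/cvgrPdist_lt => e e0.
have e0' : 0 < e%:C by rewrite ltcR.
have Foo : Filter (+oo : set_system R) by typeclasses eauto.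
have := (@cvgrPdist_lt R[i] (R[i]^o) R (+oo : set_system R) Foo _ _).1 Fz _ e0'.
apply: filterS => x.
by move=> /(le_lt_trans (normc_ge_Re _)); rewrite ltcR raddfB.
Qed.

Lemma cvg_Im F z : F x @[x --> +oo] --> (z : R[i]^o) ->
  complex.Im (F x) @[x --> +oo] --> complex.Im z.
Proof.
have ReI (y : R[i]) : complex.Re ((0 +i* (- 1)) * y) = complex.Im y.
  by case: y => a b /=; rewrite mul0r mulN1r sub0r opprK.
move=> /(@cvg_ReM F (0 +i* (- 1))); rewrite ReI; apply: cvg_trans.
by apply: near_eq_cvg; apply: nearW => x; rewrite ReI.
Qed.

Lemma Re_realM (r : R) z : complex.Re (r%:C * z) = r * complex.Re z.
Proof. by case: z => a b /=; rewrite mul0r subr0. Qed.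

Lemma cvg_real_complex (r : R -> R) (l : R) : r x @[x --> +oo] --> l ->
  (r x)%:C @[x --> +oo] --> (l%:C : R[i]^o).
Proof.
move=> rl; have Foo : Filter (+oo : set_system R) by typeclasses eauto.
apply: (@cvgrPdist_lt R[i] (R[i]^o) R (+oo : set_system R) Foo _ _).2 => e e0.
have [re0 eE] : 0 < complex.Re e /\ e = (complex.Re e)%:C.
  move: e0; rewrite ltcE/= => /andP[/eqP i0 r0]; split => //.
  by case: e i0 r0 => a b /= ->.
move/cvgrPdist_lt : rl => /(_ _ re0); apply: filterS => x.
rewrite -ltcR -eE; congr (_ < _).
by rewrite -rmorphB normc_def/= expr0n/= addr0 sqrtr_sqr.
Qed.

End complex_limits.

Section change_of_origin.
Context {R : realType}.
Local Notation mu := (@lebesgue_measure R).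
Variables (f psi : R -> R).

Definition zero_extension : R -> R := f \_ `[0, +oo[.

Lemma expiD (a b : R) : expi (a + b) = expi a * expi b.
Proof. by rewrite /expi; simpc; rewrite cosD sinD; congr (_ +i* _); ring. Qed.

Lemma shifted_integrable x :
  cintegrable `[0, +oo[ (fun t => (f t * psi (t - x))%:C * expi (- (2 * pi * 0 * t))) ->
  mu.-integrable setT (fun u => (zero_extension (x + u) * psi u)%:E).
Proof.
move=> [iRe _].
have ih : mu.-integrable setT (EFin \o (fun t => zero_extension t * psi (t - x))).
  have i0 : mu.-integrable `[0, +oo[ (EFin \o (fun t => f t * psi (t - x))).
    apply: eq_integrable iRe => // t _ /=.
    by rewrite mulr0 mul0r oppr0 cos0 sin0 mulr1 mulr0 subr0.
  have -> : (fun t => zero_extension t * psi (t - x)) =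
      (fun t => f t * psi (t - x)) \_ `[0, +oo[.
    apply/funext => t; rewrite /zero_extension !patchE.
    by case: ifPn => // _; rewrite mul0r.
  rewrite -restrict_EFin; apply/integrable_restrict => //.
  by rewrite setTI.
have [ihx _] := Rintegral_shift x ih.
apply: eq_integrable ihx => // u _ /=.
by rewrite addrAC subrr add0r.
Qed.

(** With [th = 2 * pi * xi * (a + x)], both sides are the integral of
[f t * psi (t - x) * cos (2 * pi * xi * t - th)]. *)
Lemma shifted_transform x a xi :
  mu.-integrable setT (fun u => (zero_extension (x + u) * psi u)%:E) ->
  \int[mu]_u (zero_extension (x + u) * psi u * cos (2 * pi * (u - a) * xi)) =
  complex.Re (expi (2 * pi * xi * a) * (expi (2 * pi * xi * x) *
    cintegral `[0, +oo[ (fun t => (f t * psi (t - x))%:C * expi (- (2 * pi * xi * t))))).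
Proof.
move=> ix.
have ih : mu.-integrable setT (EFin \o (fun t => zero_extension t * psi (t - x))).
  have := (Rintegral_shift (- x) ix).1; apply: eq_integrable => // t _ /=.
  by rewrite addNKr addrC.
have cont (g : R -> R) (b d : R) : continuous g ->
    measurable_fun setT (fun t => g (b * t + d)).
  move=> cg; apply: continuous_measurable_fun => t.
  apply: continuous_comp; last exact: cg.
  by apply: cvgD; [apply: cvgM; [exact: cvg_cst|exact: cvg_id]|exact: cvg_cst].
have mcos : measurable_fun setT (fun t : R => cos (- (2 * pi * xi * t))).
  have := cont (@cos R) (- (2 * pi * xi)) 0 (@continuous_cos R).
  by under eq_fun do rewrite addr0 mulNr.
have msin : measurable_fun setT (fun t : R => sin (- (2 * pi * xi * t))).
  have := cont (@sin R) (- (2 * pi * xi)) 0 (@continuous_sin R).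
  by under eq_fun do rewrite addr0 mulNr.
have cos1 (b : R) : `|cos b| <= 1 by rewrite ler_norml cos_geN1 cos_le1.
have sin1 (b : R) : `|sin b| <= 1 by rewrite ler_norml sin_geN1 sin_le1.
have ic := integrableM_bounded ih mcos (fun _ => cos1 _).
have is_ := integrableM_bounded ih msin (fun _ => sin1 _).
set th := 2 * pi * xi * (a + x).
rewrite mulrA -expiD -mulrDr -/th /cintegral/=.
have -> : \int[mu]_(t in `[0, +oo[)
    complex.Re ((f t * psi (t - x))%:C * expi (- (2 * pi * xi * t))) =
   \int[mu]_t (zero_extension t * psi (t - x) * cos (- (2 * pi * xi * t))).
  rewrite Rintegral_mkcond; apply: eq_Rintegral => t _.
  rewrite /zero_extension !patchE; case: ifPn => _ /=; last by rewrite !mul0r.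
  by rewrite mul0r subr0.
have -> : \int[mu]_(t in `[0, +oo[)
    complex.Im ((f t * psi (t - x))%:C * expi (- (2 * pi * xi * t))) =
   \int[mu]_t (zero_extension t * psi (t - x) * sin (- (2 * pi * xi * t))).
  rewrite Rintegral_mkcond; apply: eq_Rintegral => t _.
  rewrite /zero_extension !patchE; case: ifPn => _ /=; last by rewrite !mul0r.
  by rewrite mul0r addr0.
rewrite -(RintegralZl (cos th) measurableT ic) -(RintegralZl (sin th) measurableT is_).
rewrite -(RintegralB measurableT (integrableZl measurableT _ ic) (integrableZl measurableT _ is_)).
pose k t := zero_extension t * psi (t - x) * cos (2 * pi * (t - x - a) * xi).
have ik : mu.-integrable setT (EFin \o k).
  apply: (integrableM_bounded ih _ (fun _ => cos1 _)).
  have := cont (@cos R) (2 * pi * xi) (- th) (@continuous_cos R).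
  by apply: eq_measurable_fun => t _; congr cos; rewrite /th; ring.
have [_ kE] := Rintegral_shift x ik.
transitivity (\int[mu]_u k (x + u)).
  by apply: eq_Rintegral => u _; rewrite /k [x + u - x]addrAC subrr add0r.
rewrite kE; apply: eq_Rintegral => t _; rewrite /k.
have -> : 2 * pi * (t - x - a) * xi = 2 * pi * xi * t - th by rewrite /th; ring.
by rewrite cosB cosN sinN; ring.
Qed.

End change_of_origin.

(** * The Tauberian theorem *)

Theorem theorem1p1 (R : realType) (L f psi dpsi d2psi : R -> R) (beta : R)
    (J : R -> R[i])
    (hL : slowly_varying L)
    (hLb : [locally [bounded L x | x in `]0 : R, +oo[]])
    (hf0 : forall t, 0 <= t -> 0 < f t)
    (hf : forall s t, 0 <= s -> s <= t -> f s <= f t)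
    (hpsi0 : forall t, 0 < psi t)
    (hdpsi : distributional_derivative psi dpsi)
    (hd2psi : distributional_derivative dpsi d2psi)
    (hbeta : 0 <= beta)
    (hJ : forall xi : R,
      let g (x t : R) : R[i] :=
        (f t * psi (t - x))%:C * expi (- (2 * pi * xi * t)) in
      (\forall x \near +oo, cintegrable `[0, +oo[ (g x)) /\
      (expi (2 * pi * xi * x) / (expR (beta * x) * L (expR x))%:C
         * cintegral `[0, +oo[ (g x) @[x --> +oo] --> (J xi : R[i]^o))) :
  (forall eps : R, 0 < eps ->
    (\int[lebesgue_measure]_t
       ((psi t + `|dpsi t| + `|d2psi t|)
          * expR (beta * t + eps * `|t|))%:E < +oo)%E ->
    (f x / (expR (beta * x) * L (expR x)))%:C @[x --> +oo] -->
      (J 0 / (\int[lebesgue_measure]_t (psi t * expR (beta * t)))%:C : R[i]^o))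
  /\
  ((exists A : R, forall x y, 0 < x -> 0 < y -> L (x * y) <= A * L x * L y) ->
    (\int[lebesgue_measure]_t
       ((psi t + `|dpsi t| + `|d2psi t|)
          * L (expR `|t|) * expR (beta * t))%:E < +oo)%E ->
    (f x / (expR (beta * x) * L (expR x)))%:C @[x --> +oo] -->
      (J 0 / (\int[lebesgue_measure]_t (psi t * expR (beta * t)))%:C : R[i]^o)).
Proof.
have [L0 _ Lslow] := hL.
have [psi_loc _ _] := hdpsi.
have mpsi : measurable_fun setT psi by case: psi_loc.
pose F := zero_extension f.
pose lam x := L (expR x).
pose G x := expR (beta * x) * lam x.
have F_eq x : 0 <= x -> F x = f x.
  by move=> x0; rewrite /F /zero_extension patchE ifT// inE/= in_itv/= x0.
have F_neg x : x < 0 -> F x = 0.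
  move=> x0; rewrite /F /zero_extension patchE ifF//.
  by apply/negbTE/negP; rewrite inE/= in_itv/= andbT leNgt x0.
have F_ge0 x : 0 <= F x.
  by have [x0|/F_neg->//] := leP 0 x; rewrite F_eq// ltW// hf0.
have F_nd : {homo F : x y / x <= y}.
  move=> x y xy; have [x0|/F_neg->//] := leP 0 x.
  by rewrite !F_eq ?(le_trans x0 xy)//; exact: hf.
have lam_gt0 x : 0 < lam x by rewrite L0 ?expR_gt0.
have G_gt0 x : 0 < G x by rewrite mulr_gt0 ?expR_gt0.
have expRy : expR x @[x --> +oo] --> (+oo : set_system R).
  apply/cvgryPge => A; near=> x; apply: (@le_trans _ _ (1 + x)); last exact: expR_ge1Dx.
  by rewrite -lerBlDl; near: x; apply: nbhs_pinfty_ge; exact: num_real.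
have G_shift s : G (x + s) / G x @[x --> +oo] --> expR (beta * s).
  have : expR (beta * s) * (L (expR s * expR x) / L (expR x)) @[x --> +oo] --> expR (beta * s) * 1.
    by apply: cvgMr; exact: (cvg_comp _ _ expRy (Lslow _ (expR_gt0 s))).
  rewrite mulr1; apply: cvg_trans; apply: near_eq_cvg; apply: nearW => x.
  rewrite /G /lam mulrDr [x + s]addrC !expRD.
  have e0 := gt_eqF (expR_gt0 (beta * x)); have l0 := gt_eqF (lam_gt0 x).
  by field; rewrite e0 [L _ == 0]l0.
have F_int : \forall x \near +oo,
    lebesgue_measure.-integrable setT (fun u => (F (x + u) * psi u)%:E).
  by have [im _] := hJ 0; apply: filterS im => x; exact: shifted_integrable.
have transform a xi :
  (\int[lebesgue_measure]_u (F (x + u) * psi u * cos (2 * pi * (u - a) * xi))) / G x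
    @[x --> +oo] --> complex.Re (expi (2 * pi * xi * a) * J xi).
  have [_ /(@cvg_ReM R _ (expi (2 * pi * xi * a)))] := hJ xi.
  apply: cvg_trans; apply: near_eq_cvg; near=> x.
  rewrite shifted_transform; last by near: x.
  set w := expi _; set e := expi _; set C := cintegral _ _.
  have -> : w * (e / (expR (beta * x) * L (expR x))%:C * C) = (G x)^-1%:C * (w * (e * C)).
    by rewrite fmorphV; ring.
  by rewrite Re_realM mulrC.
pose j := complex.Re (J 0).
have expi0 : expi (0 : R) = 1 by rewrite /expi cos0 sin0.
have average_cvg : average F psi x / G x @[x --> +oo] --> j.
  have := transform 0 0; rewrite !mulr0 expi0 mul1r.
  apply: cvg_trans; apply: near_eq_cvg; apply: nearW => x.
  by congr (_ / _); apply: eq_Rintegral => u _; rewrite mulr0 cos0 mulr1.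
have J0E : J 0 = j%:C.
  have [_ /cvg_Im /(cvg_lim (@Rhausdorff R)) Im0] := hJ 0.
  rewrite /j; case: (J 0) Im0 => a b /= Im0; congr (_ +i* _).
  rewrite -Im0; apply/cvg_lim => //.
  apply: cvg_near_cst; apply: nearW => x.
  rewrite !mulr0 mul0r sin0 cos0.
  rewrite (@eq_Rintegral _ _ _ _ _ (cst 0)); last first.
    by move=> t _ /=; rewrite mul0r oppr0 sin0 mulr0 mul0r addr0.
  rewrite Rintegral_cst; last exact: measurable_itv.
  by rewrite !mul0r oppr0 !(mulr0, mul0r, addr0).
have /cvg_ex[c Fc] : cvg (F x / G x @[x --> +oo]).
  apply: (ratio_cvg F_nd F_ge0 hpsi0 psi_loc G_gt0 G_shift F_int average_cvg).
  by move=> a xi; apply/cvg_ex; eexists; exact: transform.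
have [j0 c0] := limit_ge0 F_ge0 hpsi0 G_gt0 average_cvg Fc.
have conclude : c = j / \int[lebesgue_measure]_t (psi t * expR (beta * t)) ->
    (f x / (expR (beta * x) * L (expR x)))%:C @[x --> +oo] -->
      (J 0 / (\int[lebesgue_measure]_t (psi t * expR (beta * t)))%:C : R[i]^o).
  move=> cE.
  have := cvg_real_complex Fc; rewrite cE J0E -fmorphV -rmorphM.
  apply: cvg_trans; apply: near_eq_cvg; near=> x.
  rewrite F_eq//; near: x; apply: nbhs_pinfty_ge; exact: num_real.
have conclude0 : j = 0 -> c = j / \int[lebesgue_measure]_t (psi t * expR (beta * t)).
  move=> j0'; rewrite j0' mul0r.
  exact: (limit_eq0 F_nd F_ge0 hpsi0 psi_loc G_gt0 G_shift F_int average_cvg Fc).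
have conclude1 : lebesgue_measure.-integrable setT (fun t => (psi t * expR (beta * t))%:E) ->
    0 < j -> j = \int[lebesgue_measure]_t (c * (psi t * expR (beta * t))) ->
    c = j / \int[lebesgue_measure]_t (psi t * expR (beta * t)).
  move=> ip jp; rewrite (RintegralZl _ measurableT ip) => jE.
  rewrite {1}jE mulfK//; apply/eqP => P0; move: jp; rewrite jE P0 mulr0 ltxx//.
have psi_le u : psi u <= psi u + `|dpsi u| + `|d2psi u|.
  by rewrite -addrA lerDl addr_ge0.
split.
- move=> e e0 hint; apply: conclude.
  have [jp|jn] := ltP 0 j; last by apply: conclude0; apply/eqP; rewrite eq_le jn.
  have iE : lebesgue_measure.-integrable setT (fun u => (psi u * expR (beta * u + e * `|u|))%:E).
    apply: (integrable_le_lower (C := 1) measurableT _ _ _ hint).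
    - apply: measurable_funM => //; apply: continuous_measurable_fun => u.
      apply: continuous_comp; last exact: continuous_expR.
      apply: cvgD; first by apply: cvgM; [exact: cvg_cst|exact: cvg_id].
      by apply: cvgM; [exact: cvg_cst|exact: norm_continuous].
    - by move=> u; rewrite mulr_ge0 ?expR_ge0// (le_trans _ (psi_le u))// ltW.
    - move=> u _; rewrite mulr_ge0 ?expR_ge0 ?(ltW (hpsi0 _))//= mul1r.
      by rewrite ler_wpM2r ?expR_ge0// psi_le.
  apply: conclude1 => //.
  apply: le_integrable iE => //.
  - by apply/measurable_EFinP; apply: measurable_funM => //; exact: measurable_expR_linear.
  - move=> u _; have pos y : 0 <= psi u * expR y by rewrite mulr_ge0 ?expR_ge0 ?ltW.
    rewrite lee_fin !(ger0_norm (pos _)).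
    by rewrite ler_wpM2l ?(ltW (hpsi0 _))// ler_expR lerDl mulr_ge0// ltW.
  exact: (moment_of_exponential_tail F_nd F_ge0 F_neg hpsi0 psi_loc hbeta G_gt0 G_shift
    F_int average_cvg Fc e0 jp iE).
- move=> [A LA] hint; apply: conclude.
  have [jp|jn] := ltP 0 j; last by apply: conclude0; apply/eqP; rewrite eq_le jn.
  have lam_sub x y : lam (x + y) <= A * lam x * lam y.
    by rewrite /lam expRD LA ?expR_gt0.
  have lam_int : (\int[lebesgue_measure]_u (psi u * lam `|u| * expR (beta * u))%:E < +oo)%E.
    apply: le_lt_trans hint; apply: le_lower_integral => u.
    rewrite !mulr_ge0 ?expR_ge0 ?(ltW (hpsi0 _)) ?(ltW (lam_gt0 _))//=.
    by rewrite !ler_wpM2r ?expR_ge0 ?(ltW (lam_gt0 _))// psi_le.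
  apply: conclude1 => //.
    exact: (integrable_moment hpsi0 psi_loc lam_gt0 G_shift lam_sub lam_int).
  exact: (moment_of_submultiplicative F_nd F_ge0 F_neg hpsi0 psi_loc hbeta lam_gt0 G_shift
    F_int average_cvg Fc jp lam_sub lam_int).
Unshelve. all: by end_near. Qed.
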